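(* Let $q$ be a non-zero complex number which is not a root of unity, let $\alpha,\beta\in\mathbb{C}^*$ and let $A_{\alpha,\beta}=U^+/\langle z-\alpha,z'-\beta\rangle$, where $U^+=U_q^+(B_2)$. Then $A_{\alpha,\beta}$ is a simple algebra with no non-trivial invertible elements (that is, every invertible element of $A_{\alpha,\beta}$ belongs to $\mathbb{C}^*$), and the center of $A_{\alpha,\beta}$ is reduced to $\mathbb{C}$.
   Context: $U^+=U_q^+(B_2)$ is the unital associative $\mathbb{C}$-algebra generated by $e_1,e_2$ subject to the quantum Serre relations $e_1^2e_2-(q^2+q^{-2})e_1e_2e_1+e_2e_1^2=0$ and $e_2^3e_1-(q^2+1+q^{-2})e_2^2e_1e_2+(q^2+1+q^{-2})e_2e_1e_2^2-e_1e_2^3=0$. Set $e_3=e_1e_2-q^2e_2e_1$, $\overline{e_3}=e_1e_2-q^{-2}e_2e_1$, $z=e_2e_3-q^2e_3e_2$ and $z'=(1-q^{-2})\left(e_3\overline{e_3}+(1+q^{-2})ze_1\right)$; the center of $U^+$ is $\mathbb{C}[z,z']$. $\langle z-\alpha,z'-\beta\rangle$ is the two-sided ideal of $U^+$ generated by $z-\alpha$ and $z'-\beta$. *)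

(* Defs.v *)
From HB Require Import structures.
From mathcomp Require Import all_boot all_algebra.
From mathcomp Require Import generic_quotient ring_quotient.
From mathcomp Require Import boolp classical_sets reals complex monalg.

Set Implicit Arguments.
Unset Strict Implicit.
Unset Printing Implicit Defensive.

Import GRing.Theory.

Local Open Scope ring_scope.
Local Open Scope quotient_scope.
Local Open Scope classical_set_scope.

Section Ideals.
Variable A : pzRingType.
Implicit Types (I S : set A) (x y : A).

(** Stability under opposite follows from [- x = (- 1) * x] and, in a unital
    algebra, stability under scaling follows from [c *: x = (c *: 1) * x]: the
    two-sided ideals of a unital algebra are those of its underlying ring. *)
Definition two_sided_ideal I : Prop :=
  [/\ I 0, forall x y, I x -> I y -> I (x + y),
      forall a x, I x -> I (a * x) & forall a x, I x -> I (x * a)].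

Definition ideal_gen S : set A :=
  [set x | forall I, two_sided_ideal I -> S `<=` I -> I x].

Lemma ideal_gen_ideal S : two_sided_ideal (ideal_gen S).
Proof.
split=> [I [] //|x y Ix Iy I idI SI|a x Ix I idI SI|a x Ix I idI SI];
  have [_ hD hl hr] := idI.
- by apply: hD; [apply: Ix|apply: Iy].
- by apply: hl; apply: Ix.
- by apply: hr; apply: Ix.
Qed.

Lemma sub_ideal_gen S : S `<=` ideal_gen S.
Proof. by move=> x Sx I _; apply. Qed.

Definition simple_algebra : Prop :=
  (1 : A) <> 0 /\
  forall I, two_sided_ideal I -> I = [set 0] \/ I = [set: A].

Definition invertible x : Prop := exists y, x * y = 1 /\ y * x = 1.

Definition center : set A := [set x | forall y, x * y = y * x].

(** Boolean form of membership, as needed by [Quotient.quot]. *)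
Definition in_ideal_gen S : A -> bool := fun x => `[< ideal_gen S x >].

Lemma in_ideal_genP S x : reflect (ideal_gen S x) (x \in in_ideal_gen S).
Proof. exact: asboolP. Qed.

Fact in_ideal_gen_zmod_closed S : zmod_closed (in_ideal_gen S).
Proof.
have [h0 hD hl _] := ideal_gen_ideal S.
split=> [|x y /in_ideal_genP Ix /in_ideal_genP Iy]; apply/in_ideal_genP => //.
by apply: hD => //; rewrite -mulN1r; apply: hl.
Qed.

HB.instance Definition _ S :=
  GRing.isZmodClosed.Build A (in_ideal_gen S) (in_ideal_gen_zmod_closed S).

Definition ideal_zmod S : zmodClosed A :=
  GRing.ZmodClosed.clone A (in_ideal_gen S) _.

(** The quotient A / <S>. As 1 may belong to <S>, it is given the structure of a
    possibly trivial ring and, when A is an algebra, of a module; it becomes an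
    [algType], which the library restricts to nontrivial rings, only when
    [1 != 0] is known. *)
Definition quot_alg S : Type := Quotient.quot (ideal_zmod S).

End Ideals.

Arguments simple_algebra A : clear implicits.
Arguments center A : clear implicits.

(** The operations are locked so that unification does not unfold them down to
    those of A. *)
HB.lock Definition quot_mul (A : pzRingType) (S : set A) (x y : quot_alg S) :
  quot_alg S := \pi_(quot_alg S) (repr x * repr y).

HB.lock Definition quot_scale (K : pzRingType) (A : algType K) (S : set A)
  (c : K) (x : quot_alg S) : quot_alg S := \pi_(quot_alg S) (c *: repr x).

Section QuotientRing.
Variables (A : pzRingType) (S : set A).

Local Notation Q := (quot_alg S).

HB.instance Definition _ := GRing.Zmodule.on Q.
HB.instance Definition _ :
    isZmodQuotient A (Quotient.equiv (ideal_zmod S)) 0 -%R +%R Q :=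
  ZmodQuotient.on Q.

Definition quot_pi (x : A) : quot_alg S := \pi_(quot_alg S) x.

Local Notation pi := quot_pi.

Lemma pi_quot_eq (x y : A) : pi x = pi y <-> ideal_gen S (x - y).
Proof.
rewrite /quot_pi; split=> [/eqP|/in_ideal_genP h].
  by rewrite -Quotient.idealrBE => /in_ideal_genP.
by apply/eqP; rewrite -Quotient.idealrBE.
Qed.

Lemma pi_quot_repr (x : A) : ideal_gen S (x - repr (pi x)).
Proof. by apply/pi_quot_eq; rewrite /quot_pi reprK. Qed.

Definition quot_one : Q := pi 1.

Lemma quot_piD x y : pi (x + y) = pi x + pi y.
Proof. by rewrite /quot_pi !piE. Qed.

Lemma quot_mulE x y : quot_mul (pi x) (pi y) = pi (x * y).
Proof.
have [_ hD hl hr] := ideal_gen_ideal S.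
rewrite unlock; apply/esym/pi_quot_eq.
set x' := repr _; set y' := repr _.
have -> : x * y - x' * y' = (x - x') * y + x' * (y - y').
  by rewrite mulrBl mulrBr addrA subrK.
by apply: hD; [apply: hr|apply: hl]; apply: pi_quot_repr.
Qed.

Lemma quotW (P : Q -> Prop) : (forall x, P (pi x)) -> forall u, P u.
Proof. by move=> h u; rewrite -[u]reprK; apply: h. Qed.

Fact quot_mulA : associative (@quot_mul A S).
Proof.
by elim/quotW=> x; elim/quotW=> y; elim/quotW=> z; rewrite !quot_mulE mulrA.
Qed.

Fact quot_mul1 : left_id quot_one (@quot_mul A S).
Proof. by elim/quotW=> x; rewrite quot_mulE mul1r. Qed.

Fact quot_1mul : right_id quot_one (@quot_mul A S).
Proof. by elim/quotW=> x; rewrite quot_mulE mulr1. Qed.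

Fact quot_mulDl : left_distributive (@quot_mul A S) +%R.
Proof.
elim/quotW=> x; elim/quotW=> y; elim/quotW=> z.
by rewrite -quot_piD !quot_mulE -quot_piD mulrDl.
Qed.

Fact quot_mulDr : right_distributive (@quot_mul A S) +%R.
Proof.
elim/quotW=> x; elim/quotW=> y; elim/quotW=> z.
by rewrite -quot_piD !quot_mulE -quot_piD mulrDr.
Qed.

HB.instance Definition _ := GRing.Zmodule_isPzRing.Build Q
  quot_mulA quot_mul1 quot_1mul quot_mulDl quot_mulDr.

Fact quot_pi_zmod_morphism : zmod_morphism pi.
Proof. by move=> x y; rewrite /quot_pi !piE. Qed.

Fact quot_pi_monoid_morphism : monoid_morphism pi.
Proof. by split=> // x y; rewrite -quot_mulE. Qed.

HB.instance Definition _ :=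
  GRing.isZmodMorphism.Build A Q pi quot_pi_zmod_morphism.
HB.instance Definition _ :=
  GRing.isMonoidMorphism.Build A Q pi quot_pi_monoid_morphism.

End QuotientRing.

Section QuotientAlgebra.
Variables (K : pzRingType) (A : algType K) (S : set A).

Local Notation Q := (quot_alg S).
Local Notation pi := (quot_pi S).

Lemma quot_scaleE c x : quot_scale c (pi x) = pi (c *: x).
Proof.
have [_ _ hl _] := ideal_gen_ideal S.
rewrite unlock; apply/esym/pi_quot_eq; rewrite -scalerBr -[_ - _]mul1r scalerAl.
by apply: hl; apply: pi_quot_repr.
Qed.

Fact quot_scaleA a b (u : Q) : quot_scale a (quot_scale b u) = quot_scale (a * b) u.
Proof. by elim/quotW: u => x; rewrite !quot_scaleE scalerA. Qed.

Fact quot_scale1 : left_id 1 (@quot_scale K A S).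
Proof. by elim/quotW=> x; rewrite quot_scaleE scale1r. Qed.

Fact quot_scaleDr : right_distributive (@quot_scale K A S) +%R.
Proof.
move=> c; elim/quotW=> x; elim/quotW=> y.
by rewrite -quot_piD !quot_scaleE -quot_piD scalerDr.
Qed.

Fact quot_scaleDl (u : Q) : {morph (@quot_scale K A S)^~ u : a b / a + b}.
Proof.
by elim/quotW: u => x a b; rewrite !quot_scaleE -quot_piD scalerDl.
Qed.

HB.instance Definition _ := GRing.Zmodule_isLmodule.Build K Q
  quot_scaleA quot_scale1 quot_scaleDr quot_scaleDl.

Lemma quot_piZ c x : pi (c *: x) = c *: pi x.
Proof. by rewrite -quot_scaleE. Qed.

Fact quot_pi_scalable : scalable pi.
Proof. by move=> c x; rewrite -quot_scaleE. Qed.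

HB.instance Definition _ :=
  GRing.isScalable.Build K A Q *:%R pi quot_pi_scalable.

Fact quot_scalerAl (c : K) (u v : Q) : c *: (u * v) = (c *: u) * v.
Proof.
elim/quotW: u => x; elim/quotW: v => y.
by rewrite -quot_pi_scalable -!rmorphM -quot_pi_scalable /= scalerAl.
Qed.

Fact quot_scalerAr (c : K) (u v : Q) : c *: (u * v) = u * (c *: v).
Proof.
elim/quotW: u => x; elim/quotW: v => y.
by rewrite -quot_pi_scalable -!rmorphM -quot_pi_scalable /= scalerAr.
Qed.

End QuotientAlgebra.

Section FreeAlgebra.
Variables (K : comNzRingType) (I : choiceType).

(** The free unital associative algebra K<I>: the algebra of the free monoid on I. *)
Definition free_alg : Type := {malg K[{fmonom I}]}.

HB.instance Definition _ := GRing.Lalgebra.on free_alg.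

Definition free_gen (i : I) : free_alg := << fmu i >>.

Fact free_scalerAr (c : K) (x y : free_alg) : c *: (x * y) = x * (c *: y).
Proof.
have mulC (g : {malg K[{fmonom I}]}) : g * c%:MP = c%:MP * g.
  rewrite !malgM_def fgmulUg fgmulgU; apply: eq_bigr => k _.
  by rewrite mulrC mul1m mulm1.
rewrite -[_ *: (x * y)]mul_malgC -[_ *: y]mul_malgC.
by rewrite mulrA -mulC mulrA.
Qed.

HB.instance Definition _ :=
  GRing.Lalgebra_isAlgebra.Build K free_alg free_scalerAr.

End FreeAlgebra.

Section UqB2.
Variable (R : realType).
Local Notation C := R[i].
Variable (q : C).

Local Notation F := (free_alg C 'I_2).
Local Notation X1 := (free_gen C (ord0 : 'I_2)).
Local Notation X2 := (free_gen C (ord_max : 'I_2)).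

Definition serre1 (A : algType C) (x1 x2 : A) : A :=
  x1 ^+ 2 * x2 - (q ^+ 2 + q ^- 2) *: (x1 * x2 * x1) + x2 * x1 ^+ 2.

Definition serre2 (A : algType C) (x1 x2 : A) : A :=
  x2 ^+ 3 * x1 - (q ^+ 2 + 1 + q ^- 2) *: (x2 ^+ 2 * x1 * x2)
  + (q ^+ 2 + 1 + q ^- 2) *: (x2 * x1 * x2 ^+ 2) - x1 * x2 ^+ 3.

Definition serre_relations : set F := [set serre1 X1 X2; serre2 X1 X2].

Definition Uplus : Type := quot_alg serre_relations.

HB.instance Definition _ := GRing.PzRing.on Uplus.
HB.instance Definition _ := GRing.Lmodule.on Uplus.

Lemma serre_eq0 (A : algType C) (f : {rmorphism A -> C}) (x1 x2 : A) :
  (forall c x, f (c *: x) = c * f x) -> f x1 = 0 -> f x2 = 0 ->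
  f (serre1 x1 x2) = 0 /\ f (serre2 x1 x2) = 0.
Proof.
move=> fZ f1 f2; rewrite /serre1 /serre2.
rewrite !(rmorphD, rmorphN, fZ, rmorphM, rmorphXn) /=.
by rewrite f1 f2 !(mul0r, mulr0, expr0n, oppr0, addr0).
Qed.

Fact Uplus_oner_neq0 : (1 : Uplus) != 0.
Proof.
apply/eqP => e10; have {e10} : ideal_gen serre_relations 1.
  by rewrite -[1]subr0; apply/pi_quot_eq; rewrite rmorph1 rmorph0.
pose f : {rmorphism F -> C} := @mcoeff {fmonom 'I_2} C mone.
have fX (i : 'I_2) : f (free_gen C i) = 0.
  change (@mcoeff {fmonom 'I_2} C mone << fmu i >> = 0).
  by rewrite mcoeffU -val_eqE /= fmuE fm1.
have fZ c (x : F) : f (c *: x) = c * f x by exact: mcoeffZ.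
have [s1 s2] := serre_eq0 fZ (fX ord0) (fX ord_max).
move/(_ [set x | f x = 0]) => h.
clearbody f.
have : f 1 = 0; last by rewrite rmorph1 => /eqP; rewrite oner_eq0.
apply: h => [|x [] -> //].
split=> [|x y /= hx hy|a x /= hx|a x /= hx]; first exact: rmorph0.
- by rewrite rmorphD hx hy addr0.
- by rewrite rmorphM hx mulr0.
- by rewrite rmorphM hx mul0r.
Qed.

HB.instance Definition _ :=
  GRing.PzSemiRing_isNonZero.Build Uplus Uplus_oner_neq0.
HB.instance Definition _ :=
  GRing.Lmodule_isLalgebra.Build C Uplus (@quot_scalerAl _ _ _).
HB.instance Definition _ :=
  GRing.Lalgebra_isAlgebra.Build C Uplus (@quot_scalerAr _ _ _).

Definition Uplus_pi : F -> Uplus := quot_pi serre_relations.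

HB.instance Definition _ := GRing.isZmodMorphism.Build F Uplus Uplus_pi
  (quot_pi_zmod_morphism serre_relations).
HB.instance Definition _ := GRing.isMonoidMorphism.Build F Uplus Uplus_pi
  (quot_pi_monoid_morphism serre_relations).
HB.instance Definition _ := GRing.isScalable.Build C F Uplus *:%R Uplus_pi
  (quot_pi_scalable serre_relations).

Definition e1 : Uplus := Uplus_pi X1.
Definition e2 : Uplus := Uplus_pi X2.

Lemma serre_morph (A B : algType C) (f : {rmorphism A -> B}) (x1 x2 : A) :
  scalable f ->
  f (serre1 x1 x2) = serre1 (f x1) (f x2) /\
  f (serre2 x1 x2) = serre2 (f x1) (f x2).
Proof.
move=> fZ; rewrite /serre1 /serre2.
by rewrite !(rmorphD, rmorphN, fZ, rmorphM, rmorphXn).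
Qed.

Lemma Uplus_serre : serre1 e1 e2 = 0 /\ serre2 e1 e2 = 0.
Proof.
have pi0 x : ideal_gen serre_relations x -> Uplus_pi x = 0.
  by move=> Sx; rewrite -(rmorph0 Uplus_pi); apply/pi_quot_eq; rewrite subr0.
have [<- <-] := serre_morph X1 X2 (quot_pi_scalable _ : scalable Uplus_pi).
by split; apply: pi0; apply: sub_ideal_gen; [left|right].
Qed.

Definition e3 : Uplus := e1 * e2 - q ^+ 2 *: (e2 * e1).
Definition e3bar : Uplus := e1 * e2 - q ^- 2 *: (e2 * e1).
Definition z : Uplus := e2 * e3 - q ^+ 2 *: (e3 * e2).
Definition z' : Uplus :=
  (1 - q ^- 2) *: (e3 * e3bar + (1 + q ^- 2) *: (z * e1)).

Definition central_relations (alpha beta : C) : set Uplus :=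
  [set z - alpha *: 1; z' - beta *: 1].

Definition Aab (alpha beta : C) : Type := quot_alg (central_relations alpha beta).

HB.instance Definition _ (alpha beta : C) := GRing.PzRing.on (Aab alpha beta).
HB.instance Definition _ (alpha beta : C) :=
  GRing.Lmodule.on (Aab alpha beta).

Definition Aab_pi (alpha beta : C) : Uplus -> Aab alpha beta :=
  quot_pi (central_relations alpha beta).

Lemma Aab_piE (alpha beta : C) :
  Aab_pi alpha beta z = alpha *: (1 : Aab alpha beta) /\
  Aab_pi alpha beta z' = beta *: (1 : Aab alpha beta).
Proof.
have pi1 c : Aab_pi alpha beta (c *: 1) = c *: (1 : Aab alpha beta).
  exact: (quot_pi_scalable (central_relations alpha beta) c 1).
by rewrite -!pi1; split; apply/pi_quot_eq; apply: sub_ideal_gen; [left|right].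
Qed.

End UqB2.

(* Main.v *)
From HB Require Import structures.
From mathcomp Require Import all_boot all_order all_algebra.
From mathcomp Require Import zify ring.
From mathcomp Require Import generic_quotient finmap boolp classical_sets functions.
From mathcomp Require Import reals complex monalg.
Require Import Defs.

(** Write r = q^2, x = e1, e = e2, y = e3. In A the relation z' = beta gives
    y^2 = b0 + b1 xye + b2 x, so A is spanned by the x^i y^d e^j with d <= 1.
    Acting on the left, A maps to the skew Laurent polynomials in y over
    functions of x, where yx = rxy and e = Ac(x) y^-1 + Bc(x) y with
    Ac(t) = a/t + c and Bc(t) = 1/((1 - r^2) t); the coefficients at the extreme
    powers of y show that this map is injective. A unit and its inverse must be
    homogeneous in y; since Ac vanishes at the nonzero point -a/c, the factor of
    nonpositive degree is a polynomial in x, hence both are constants. A nonzero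
    ideal contains a y-homogeneous element (commute with x), then a monomial
    x^s y^j (commute with y), then a power of x and finally 1 (commute with e).
    A nonzero central element generates A as an ideal, hence is a unit, hence is
    scalar. *)

Set Implicit Arguments.
Unset Strict Implicit.
Unset Printing Implicit Defensive.

Import Order.TTheory GRing.Theory Num.Theory.
Local Open Scope ring_scope.
Local Open Scope classical_set_scope.

(** * Scaling by powers of a non-root of unity *)

Section Scaling.
Variables (F : fieldType) (r : F).
Hypotheses (r_neq0 : r != 0) (r_nroot : forall n, (0 < n)%N -> r ^+ n != 1).

Definition rshift (k : int) (t : F) := r ^ k * t.

Lemma rshift0 t : rshift 0 t = t.
Proof. by rewrite /rshift expr0z mul1r. Qed.

Lemma rshiftA k l t : rshift k (rshift l t) = rshift (k + l) t.
Proof. by rewrite /rshift mulrA -expfzDr. Qed.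

Lemma rshift_neq0 k t : t != 0 -> rshift k t != 0.
Proof. by move=> t0; rewrite mulf_neq0 // expfz_neq0. Qed.

Lemma exprz_neq1 (k : int) : k != 0 -> r ^ k != 1.
Proof.
case: k => n n0; first by rewrite -exprnP r_nroot // lt0n.
by rewrite NegzE -exprnN invr_eq1 r_nroot.
Qed.

(** The powers of [r] are nonzero and pairwise distinct, so [p] has more roots than its size
    allows. *)
Lemma poly_eq0_nz (p : {poly F}) : (forall t, t != 0 -> p.[t] = 0) -> p = 0.
Proof.
move=> p0; apply/eqP/negPn/negP => pn0.
have : (size [seq r ^+ i | i <- iota 0 (size p)] < size p)%N; last first.
  by rewrite size_map size_iota ltnn.
apply: max_poly_roots => //.
  by apply/allP => _ /mapP [i _ ->]; rewrite rootE p0 // expf_neq0.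
rewrite map_inj_in_uniq ?iota_uniq // => i j _ _ /= rij.
wlog ij : i j rij / (i <= j)%N.
  by move=> h; case/orP: (leq_total i j) => /h -> //.
apply/eqP; rewrite eqn_leq ij leqNgt /=; apply/negP => ltij.
have /eqP [] : r ^+ (j - i) != 1 by rewrite r_nroot // subn_gt0.
by apply: (mulIf (expf_neq0 i r_neq0)); rewrite -exprD mul1r subnK.
Qed.

End Scaling.

(** * Coefficients of skew Laurent polynomials in [y] *)

Section LaurentCoefficients.
Variables (F : fieldType) (r : F).
Hypotheses (r_neq0 : r != 0) (r_nroot : forall n, (0 < n)%N -> r ^+ n != 1).
Variables (a c : F).
Hypotheses (a_neq0 : a != 0) (c_neq0 : c != 0).
(* [coef u k t] is the value at x = t of the coefficient of y^k in u; nothing is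
   assumed at t = 0. *)
Variables (A : algType F) (x e y : A) (coef : A -> int -> F -> F).

Local Notation sh := (rshift r).

Definition Ac (t : F) := a / t + c.
Definition Bc (t : F) := ((1 - r ^+ 2) * t)^-1.

Hypothesis def_y : y = x * e - r *: (e * x).
(** Generation of [A] by [x] and [e], phrased as an induction along left multiplication, the side on
    which [coef_xl] and [coef_el] compute coefficients. *)
Hypothesis gen : forall P : A -> Prop, P 1 ->
  (forall u v, P u -> P v -> P (u + v)) -> (forall k u, P u -> P (k *: u)) ->
  (forall u, P u -> P (x * u)) -> (forall u, P u -> P (e * u)) -> forall u, P u.
Hypothesis cfD : forall u v k t, coef (u + v) k t = coef u k t + coef v k t.
Hypothesis cfZ : forall d u k t, coef (d *: u) k t = d * coef u k t.
Hypothesis cf1 : forall k (t : F), t != 0 -> coef 1 k t = (k == 0)%:R.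
Hypothesis coef_xl : forall u k (t : F), t != 0 -> coef (x * u) k t = t * coef u k t.
Hypothesis coef_el : forall u k (t : F), t != 0 ->
  coef (e * u) k t = Ac t * coef u (k + 1) (sh (-1) t)
                   + Bc t * coef u (k - 1) (sh 1 t).

Lemma r2_neq1 : 1 - r ^+ 2 != 0.
Proof. by rewrite subr_eq0 eq_sym r_nroot. Qed.

Lemma cf0 k t : coef 0 k t = 0.
Proof. by rewrite -(scale0r 1) cfZ mul0r. Qed.

Lemma cfN u k t : coef (- u) k t = - coef u k t.
Proof. by rewrite -scaleN1r cfZ mulN1r. Qed.

Lemma cfB u v k t : coef (u - v) k t = coef u k t - coef v k t.
Proof. by rewrite cfD cfN. Qed.

(** Left multiplications commute with right ones, so induction on [u] reduces to [u = 1]. The factor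
    r^k is the cost of moving [x] to the left of y^k. *)
Lemma coef_xr u k t : t != 0 -> coef (u * x) k t = coef u k t * sh k t.
Proof.
elim/gen: u k t => [k t t0|u v hu hv k t t0|d u hu k t t0|u hu k t t0|u hu k t t0].
- rewrite mul1r -[x]mulr1 coef_xl // cf1 //.
  by case: eqP => [->|]; rewrite ?rshift0 ?mulr1 ?mul1r ?mulr0 ?mul0r.
- by rewrite mulrDl !cfD hu // hv // mulrDl.
- by rewrite -scalerAl !cfZ hu // mulrA.
- by rewrite -mulrA !coef_xl // hu // mulrA.
- rewrite -mulrA !coef_el // !hu ?rshift_neq0 // !rshiftA // addrK subrK.
  ring.
Qed.

Lemma coef_er u k t : t != 0 ->
  coef (u * e) k t = coef u (k + 1) t * Ac (sh (k + 1) t)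
                   + coef u (k - 1) t * Bc (sh (k - 1) t).
Proof.
elim/gen: u k t => [k t t0|u v hu hv k t t0|d u hu k t t0|u hu k t t0|u hu k t t0].
- rewrite mul1r -[e]mulr1 coef_el // !cf1 ?rshift_neq0 //.
  by case: eqP => [->|]; case: eqP => [->|]; rewrite ?rshift0 ?mulr1 ?mul1r ?mulr0 ?mul0r.
- by rewrite mulrDl !cfD hu // hv //; ring.
- by rewrite -scalerAl !cfZ hu //; ring.
- by rewrite -mulrA !coef_xl // hu //; ring.
- rewrite -mulrA !coef_el // !hu ?rshift_neq0 // !rshiftA // !(addrK, subrK).
  ring.
Qed.

(** In [x * e - r *: (e * x)] the [Ac] terms cancel, and the denominator of [Bc] normalises the
    remaining one to a pure shift of degree. *)
Lemma coef_yl u k t : t != 0 -> coef (y * u) k t = coef u (k - 1) (sh 1 t).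
Proof.
move=> t0; rewrite def_y mulrBl -scalerAl cfB cfZ -!mulrA coef_xl //.
rewrite !coef_el // !coef_xl ?rshift_neq0 // /Bc /Ac /rshift.
rewrite expr1z exprN1.
have r1 := r2_neq1. field; rewrite ?r_neq0 ?t0 ?r1 //.
Qed.

Lemma coef_yr u k t : t != 0 -> coef (u * y) k t = coef u (k - 1) t.
Proof.
move=> t0; rewrite def_y mulrBr -scalerAr cfB cfZ !mulrA.
rewrite coef_er // !coef_xr // coef_er //.
have r1 := r2_neq1; have st := rshift_neq0 r_neq0 k t0.
rewrite /Bc /Ac !(addrC k) -!rshiftA //.
move: st; set s := sh k t => st.
rewrite /rshift expr1z exprN1.
by field; rewrite r_neq0 st r1.
Qed.

Lemma coef_xnl n u k t : t != 0 -> coef (x ^+ n * u) k t = t ^+ n * coef u k t.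
Proof.
move=> t0; elim: n => [|n IHn]; first by rewrite !mul1r.
by rewrite exprS -mulrA coef_xl // IHn exprS mulrA.
Qed.

Lemma coef_ynr n u k t : t != 0 -> coef (u * y ^+ n) k t = coef u (k - n%:Z) t.
Proof.
move=> t0; elim: n k => [|n IHn] k; first by rewrite mulr1 subr0.
rewrite exprSr mulrA coef_yr // IHn; congr coef; lia.
Qed.

Definition hx (p : {poly F}) : A := horner_alg x p.

Lemma coef_hxl p u k t : t != 0 -> coef (hx p * u) k t = p.[t] * coef u k t.
Proof.
move=> t0; elim/poly_ind: p u => [|p d IHp] u.
  by rewrite /hx rmorph0 mul0r cf0 horner0 mul0r.
rewrite /hx rmorphD rmorphM /= horner_algX horner_algC mulrDl cfD -mulrA.
by rewrite IHp coef_xl // mulr_algl cfZ !hornerE /=; ring.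
Qed.

Lemma coef_hx p k t : t != 0 -> coef (hx p) k t = p.[t] * (k == 0)%:R.
Proof. by move=> t0; rewrite -[hx p]mulr1 coef_hxl // cf1. Qed.

(** * Extreme degrees after multiplication by powers of [e] *)

Definition supp_le u (h : int) :=
  forall k (t : F), t != 0 -> h < k -> coef u k t = 0.
Definition supp_ge u (l : int) :=
  forall k (t : F), t != 0 -> k < l -> coef u k t = 0.

(** At the bottom degree each factor [e] contributes only its y^-1 part; moving [Ac] past the power
    of [y] on its left shifts its argument. The support bound is proved jointly since the induction
    consumes it. *)
Lemma coef_en_low n u l : supp_ge u l ->
  supp_ge (u * e ^+ n) (l - n%:Z) /\
  forall t : F, t != 0 -> coef (u * e ^+ n) (l - n%:Z) t
    = coef u l t * \prod_(i < n) Ac (sh (l - i%:Z) t).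
Proof.
move=> ul; elim: n => [|n [IH1 IH2]].
  by rewrite mulr1 subr0; split=> // t t0; rewrite big_ord0 mulr1.
rewrite exprSr mulrA; split=> [k t t0 kl|t t0]; rewrite coef_er //.
  by rewrite !IH1 ?mul0r ?addr0 //; lia.
rewrite [X in _ + X * _]IH1 //; last lia.
have -> : l - n.+1%:Z + 1 = l - n%:Z by lia.
by rewrite IH2 // mul0r addr0 big_ord_recr mulrA.
Qed.

Lemma coef_en_top n u h : supp_le u h ->
  supp_le (u * e ^+ n) (h + n%:Z) /\
  forall t : F, t != 0 -> coef (u * e ^+ n) (h + n%:Z) t
    = coef u h t * \prod_(i < n) Bc (sh (h + i%:Z) t).
Proof.
move=> uh; elim: n => [|n [IH1 IH2]].
  by rewrite mulr1 addr0; split=> // t t0; rewrite big_ord0 mulr1.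
rewrite exprSr mulrA; split=> [k t t0 kl|t t0]; rewrite coef_er //.
  by rewrite !IH1 ?mul0r ?addr0 //; lia.
rewrite [X in X * _ + _]IH1 //; last lia.
have -> : h + n.+1%:Z - 1 = h + n%:Z by lia.
by rewrite IH2 // mul0r add0r big_ord_recr mulrA.
Qed.

(** * Normal forms and their faithfulness *)

Lemma coef_hxy P Q k t : t != 0 ->
  coef (hx P + hx Q * y) k t = P.[t] * (k == 0)%:R + Q.[t] * (k == 1)%:R.
Proof. by move=> t0; rewrite cfD coef_yr // !coef_hx // subr_eq0. Qed.

Lemma supp_hxy P Q :
  supp_ge (hx P + hx Q * y) 0 /\ supp_le (hx P + hx Q * y) 1.
Proof.
have out k t : t != 0 -> k != 0 -> k != 1 -> coef (hx P + hx Q * y) k t = 0.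
  by move=> t0 k0 k1; rewrite coef_hxy // (negPf k0) (negPf k1) !mulr0 addr0.
split=> k t t0 k01; apply: out => //; rewrite ?(lt_eqF k01) ?(gt_eqF k01) //.
  by rewrite (lt_eqF (lt_trans k01 _)).
by rewrite (gt_eqF (lt_trans _ k01)).
Qed.

(** Elements spanned by the x^i y^d e^j with d <= 1 and j < n, grouped by powers of [e]: the
    outermost term is the only one that can reach the degrees 1 - n and n, so induction can strip
    it. *)
Fixpoint nf n u : Prop :=
  if n is m.+1 then exists u' P Q, nf m u' /\ u = u' + (hx P + hx Q * y) * e ^+ m
  else u = 0.

Lemma nf_supp n u : nf n u -> supp_le u n%:Z /\ supp_ge u (1 - n%:Z).
Proof.
elim: n u => [|n IHn] u /=; first by move=> ->; split=> k t _ _; rewrite cf0.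
move=> [u' [P [Q [/IHn [h1 h2] ->]]]].
have [t1 _] := coef_en_top n (supp_hxy P Q).2.
have [t2 _] := coef_en_low n (supp_hxy P Q).1.
split=> k t t0 kn; rewrite cfD.
  by rewrite h1 ?t1 ?addr0 //; lia.
by rewrite h2 ?t2 ?addr0 //; lia.
Qed.

(** Lower powers of [e] stay above degree -n, and so does the part with [Q], which starts one degree
    higher. *)
Lemma nf_low n u P Q t : t != 0 -> nf n u ->
  coef (u + (hx P + hx Q * y) * e ^+ n) (- n%:Z) t
  = P.[t] * \prod_(i < n) Ac (sh (- i%:Z) t).
Proof.
move=> t0 /nf_supp [_ hu]; rewrite cfD hu ?add0r //; last lia.
have [_] := coef_en_low n (supp_hxy P Q).1.
rewrite sub0r => -> //; rewrite coef_hxy // mulr1 mulr0 addr0.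
by under eq_bigr do rewrite sub0r.
Qed.

Lemma nf_top n u P Q t : t != 0 -> nf n u ->
  coef (u + (hx P + hx Q * y) * e ^+ n) (n.+1%:Z) t
  = Q.[t] * \prod_(i < n) Bc (sh (1 + i%:Z) t).
Proof.
move=> t0 /nf_supp [hu _]; rewrite cfD hu ?add0r //; last lia.
have [_] := coef_en_top n (supp_hxy P Q).2.
have -> : n.+1%:Z = 1 + n%:Z by lia.
by move=> -> //; rewrite coef_hxy // mulr1 mulr0 add0r.
Qed.

Lemma mul_prod_Ac_eq0 n P :
  (forall t : F, t != 0 -> P.[t] * \prod_(i < n) Ac (sh (- i%:Z) t) = 0) -> P = 0.
Proof.
(* Clears the denominator of a shifted [Ac]: the value of [G i] at t is s * Ac(s) with s = r^-i t.
   Its constant term [a] is nonzero. *)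
pose G i : {poly F} := a%:P + (c * r ^ (- i%:Z)) *: 'X.
have Gn0 i : G i != 0.
  apply/eqP => /polyP /(_ 0%N) /eqP; rewrite coef0 !(coefD, coefC, coefZ, coefX) /=.
  by rewrite mulr0 addr0 (negPf a_neq0).
move=> h; have /eqP : P * \prod_(i < n) G i = 0; last first.
  by rewrite mulf_eq0 => /orP [/eqP //|/prodf_eq0 [i _]]; rewrite (negPf (Gn0 i)).
apply: (poly_eq0_nz r_neq0 r_nroot) => t t0.
rewrite hornerM horner_prod.
have Gt (i : 'I_n) : (G i).[t] = sh (- i%:Z) t * Ac (sh (- i%:Z) t).
  have st := rshift_neq0 r_neq0 (- i%:Z) t0; rewrite !hornerE /Ac mulrDr mulrCA.
  by rewrite divff // mulr1 /rshift [in RHS]mulrC mulrA.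
under eq_bigr do rewrite Gt.
by rewrite big_split mulrCA h // mulr0.
Qed.

Lemma Bc_neq0 t : t != 0 -> Bc t != 0.
Proof. by move=> t0; rewrite /Bc invr_neq0 // mulf_neq0 // r2_neq1. Qed.

Lemma mul_prod_Bc_eq0 n Q :
  (forall t : F, t != 0 -> Q.[t] * \prod_(i < n) Bc (sh (1 + i%:Z) t) = 0) -> Q = 0.
Proof.
move=> h; apply: (poly_eq0_nz r_neq0 r_nroot) => t t0.
apply/eqP; have /eqP := h t t0; rewrite mulf_eq0 => /orP [//|/prodf_eq0 [i _]].
by rewrite (negPf (Bc_neq0 (rshift_neq0 r_neq0 _ t0))).
Qed.

Lemma hx0 : hx 0 = 0. Proof. exact: rmorph0. Qed.
Lemma hx1 : hx 1 = 1. Proof. exact: rmorph1. Qed.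
Lemma hxX : hx 'X = x. Proof. exact: horner_algX. Qed.
Lemma hxC d : hx d%:P = d%:A. Proof. exact: horner_algC. Qed.
Lemma hxD P Q : hx (P + Q) = hx P + hx Q. Proof. exact: rmorphD. Qed.
Lemma hxM P Q : hx (P * Q) = hx P * hx Q. Proof. exact: rmorphM. Qed.
Lemma hxZ d P : hx (d *: P) = d *: hx P. Proof. by rewrite -mul_polyC hxM hxC mulr_algl. Qed.

(** The bottom coefficient kills [P] and the top one kills [Q], so the outermost term disappears and
    the induction continues. *)
Lemma nf_faithful n u : nf n u ->
  (forall k (t : F), t != 0 -> coef u k t = 0) -> u = 0.
Proof.
elim: n u => [//|n IHn] u [u' [P [Q [nu' def_u]]]] u0.
have P0 : P = 0.
  by apply: (@mul_prod_Ac_eq0 n) => t t0; rewrite -(nf_low P Q t0 nu') -def_u u0.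
have Q0 : Q = 0.
  by apply: (@mul_prod_Bc_eq0 n) => t t0; rewrite -(nf_top P Q t0 nu') -def_u u0.
move: def_u u0; rewrite P0 Q0 hx0 mul0r addr0 mul0r addr0 => ->.
exact: IHn.
Qed.

(** * Spanning by normal forms *)

Variables (al b0 b1 b2 : F).
Hypotheses (al_neq0 : al != 0) (b0_neq0 : b0 != 0).
Hypothesis rel_xy : x * y = r^-1 *: (y * x).
Hypothesis rel_ey : e * y = r *: (y * e) + al *: 1.
Hypothesis rel_yy : y * y = b0 *: 1 + b1 *: (x * y * e) + b2 *: x.

Lemma rel_yx : y * x = r *: (x * y).
Proof. by rewrite rel_xy scalerA divff // scale1r. Qed.

Lemma rel_ex : e * x = r^-1 *: (x * e - y).
Proof. by rewrite def_y opprB addrC subrK scalerA mulVf // scale1r. Qed.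

Lemma nf0 n : nf n 0.
Proof. by elim: n => //= n IHn; exists 0, 0, 0; rewrite hx0 mul0r addr0 mul0r addr0. Qed.

Lemma nfD n u v : nf n u -> nf n v -> nf n (u + v).
Proof.
elim: n u v => [|n IHn] u v /=; first by move=> -> ->; rewrite addr0.
move=> [u' [P [Q [nu ->]]]] [v' [P' [Q' [nv ->]]]].
exists (u' + v'), (P + P'), (Q + Q'); split; first exact: IHn.
by rewrite addrACA -mulrDl addrACA !hxD -mulrDl.
Qed.

Lemma nf_hxl n R u : nf n u -> nf n (hx R * u).
Proof.
elim: n u => [|n IHn] u /=; first by move=> ->; rewrite mulr0.
move=> [u' [P [Q [nu ->]]]]; exists (hx R * u'), (R * P), (R * Q).
by split; [exact: IHn|rewrite !hxM -[hx R * hx Q * y]mulrA -mulrDr -[hx R * _ * _]mulrA mulrDr].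
Qed.

Lemma nfZ n d u : nf n u -> nf n (d *: u).
Proof. by move=> nu; rewrite -mulr_algl -hxC; apply: nf_hxl. Qed.

Lemma nf_xl n u : nf n u -> nf n (x * u).
Proof. by move=> nu; rewrite -hxX; apply: nf_hxl. Qed.

Lemma nfS n u : nf n u -> nf n.+1 u.
Proof. by move=> nu; exists u, 0, 0; rewrite hx0 mul0r addr0 mul0r addr0. Qed.

Lemma nf_le m n u : (m <= n)%N -> nf m u -> nf n u.
Proof. by move=> /subnK <-; elim: (n - m)%N => // k IHk /IHk /nfS. Qed.

Lemma nf_en n : nf n.+1 (e ^+ n).
Proof.
exists 0, 1, 0; split; first exact: nf0.
by rewrite hx0 hx1 mul0r addr0 mul1r add0r.
Qed.

Lemma nf_yen n : nf n.+1 (y * e ^+ n).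
Proof.
exists 0, 0, 1; split; first exact: nf0.
by rewrite hx0 hx1 mul1r !add0r.
Qed.

Lemma nf_yyen n : nf n.+2 (y * y * e ^+ n).
Proof.
rewrite rel_yy !mulrDl -!scalerAl mul1r -!mulrA -exprS.
have n1 := nf_en n; have n2 := nf_yen n.+1.
by apply: nfD; [apply: nfD|]; apply: nfZ; do ?apply: nf_xl => //;
  apply: nfS => //; apply: nf_xl.
Qed.

Lemma hx_el P : exists P' P'', e * hx P = hx P' * e + hx P'' * y.
Proof.
elim/poly_ind: P => [|P d [P' [P'' IHP]]].
  by exists 0, 0; rewrite hx0 mulr0 !mul0r addr0.
(* Read off by multiplying the inductive expression by [x] on the right and applying [rel_ex] and
   [rel_yx]. *)
exists (r^-1 *: P' * 'X + d%:P), (r *: P'' * 'X - r^-1 *: P').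
rewrite -scaleNr !(hxD, hxM, hxC, hxX, hxZ) mulrDr (mulrA e) IHP !mulrDl.
rewrite -!(mulrA (hx _)) rel_yx rel_ex -!(scalerAl, scalerAr) mulr1 mul1r.
rewrite mulrBr scalerBr scaleNr -!mulrA.
by rewrite -addrA addrACA [RHS]addrACA [- _ + _]addrC.
Qed.

(** [e] is moved right past the polynomials by [hx_el] and past [y] by [rel_ey]; any y^2 so created
    is removed by [rel_yy]. The power of [e] grows by at most one. *)
Lemma nf_el n u : nf n u -> nf n.+1 (e * u).
Proof.
elim: n u => [|n IHn] u; first by move=> ->; rewrite mulr0; apply: nf0.
move=> [u' [P [Q [/IHn nu ->]]]]; rewrite mulrDr; apply: nfD; first exact: nfS.
have [P1 [P2 eP]] := hx_el P; have [Q1 [Q2 eQ]] := hx_el Q.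
rewrite mulrA mulrDr mulrA eP eQ !mulrDl.
apply: nfD; apply: nfD; rewrite -?mulrA; apply: nf_hxl.
- by rewrite -exprS; apply: nf_en.
- by apply: nfS; apply: nf_yen.
- rewrite mulrA rel_ey mulrDl -!scalerAl mul1r -mulrA -exprS.
  by apply: nfD; apply: nfZ; [apply: nf_yen|apply: nfS; apply: nf_en].
- by rewrite mulrA; apply: nf_yyen.
Qed.

Lemma nf_ex u : exists n, nf n u.
Proof.
elim/gen: u => [|u v [m hu] [n hv]|d u [n hu]|u [n hu]|u [n hu]].
- by exists 1%N; apply: nf_en.
- exists (maxn m n); apply: nfD; [apply: nf_le hu|apply: nf_le hv].
    exact: leq_maxl.
  exact: leq_maxr.
- by exists n; apply: nfZ.
- by exists n; apply: nf_xl.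
- by exists n.+1; apply: nf_el.
Qed.

(** Every element has a normal form, so [nf_faithful] applies to the difference: identities in [A]
    may be checked on coefficients. *)
Lemma coef_inj u v : (forall k (t : F), t != 0 -> coef u k t = coef v k t) -> u = v.
Proof.
move=> uv; apply/eqP; rewrite -subr_eq0; apply/eqP; have [n] := nf_ex (u - v).
by move=> /nf_faithful; apply=> k t t0; rewrite cfB uv // subrr.
Qed.

Lemma coef_neq0 u : u <> 0 -> exists k t, t != 0 /\ coef u k t != 0.
Proof.
move=> u0; apply: contrapT => h; apply: u0; apply: coef_inj => k t t0.
by rewrite cf0; apply: contrapT => /eqP ?; apply: h; exists k, t.
Qed.

(** * Coefficients as Laurent polynomial functions *)

Definition laurent (f : F -> F) :=
  exists m P, forall t : F, t != 0 -> t ^+ m * f t = P.[t].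

Lemma laurentD f g : laurent f -> laurent g -> laurent (fun t => f t + g t).
Proof.
move=> [m [P hP]] [n [Q hQ]]; exists (m + n)%N, ('X^n * P + 'X^m * Q) => t t0.
rewrite !hornerE -hP // -hQ // exprD. move: (t ^+ m) (t ^+ n) => *; ring.
Qed.

Lemma laurentM f g : laurent f -> laurent g -> laurent (fun t => f t * g t).
Proof.
move=> [m [P hP]] [n [Q hQ]]; exists (m + n)%N, (P * Q) => t t0.
by rewrite hornerM -hP // -hQ // exprD mulrACA.
Qed.

Lemma laurentC d : laurent (fun=> d).
Proof. by exists 0%N, d%:P => t t0; rewrite hornerC mul1r. Qed.

Lemma laurentX : laurent id.
Proof. by exists 0%N, 'X => t t0; rewrite hornerX mul1r. Qed.

Lemma laurentV : laurent GRing.inv.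
Proof. by exists 1%N, 1 => t t0; rewrite hornerC mulfV. Qed.

Lemma laurent_shift k f : laurent f -> laurent (fun t => f (sh k t)).
Proof.
move=> [m [P hP]]; exists m, (((r ^ k) ^+ m)^-1 *: (P \Po ((r ^ k) *: 'X))) => t t0.
rewrite hornerZ horner_comp !hornerE -hP ?rshift_neq0 // /rshift exprMn -mulrA.
by rewrite mulKf // expf_neq0 // expfz_neq0.
Qed.

Lemma laurent_eq f g : (forall t : F, t != 0 -> f t = g t) -> laurent f -> laurent g.
Proof. by move=> fg [m [P hP]]; exists m, P => t t0; rewrite -fg ?hP. Qed.

(** After clearing powers of t this is the absence of zero divisors in [{poly F}]. *)
Lemma laurent_dom f g : laurent f -> laurent g ->
  (forall t : F, t != 0 -> f t * g t = 0) ->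
  (exists t, t != 0 /\ f t != 0) -> forall t : F, t != 0 -> g t = 0.
Proof.
move=> [m [P hP]] [n [Q hQ]] fg [s [s0 fs]] t t0.
have /eqP : P * Q = 0.
  apply: (poly_eq0_nz r_neq0 r_nroot) => z z0.
  by rewrite hornerM -hP // -hQ // mulrACA fg // mulr0.
rewrite mulf_eq0 => /orP [] /eqP E.
  move: (hP s s0); rewrite E horner0 => /eqP.
  by rewrite mulf_eq0 (negPf fs) expf_eq0 (negPf s0) andbF.
move: (hQ t t0); rewrite E horner0 => /eqP.
by rewrite mulf_eq0 expf_eq0 (negPf t0) andbF => /eqP.
Qed.

Lemma laurent_coef u k : laurent (coef u k).
Proof.
elim/gen: u k => [k|u v hu hv k|d u hu k|u hu k|u hu k].
- by apply: laurent_eq (laurentC (k == 0)%:R) => t t0; rewrite cf1.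
- by apply: laurent_eq (laurentD (hu k) (hv k)) => t t0; rewrite cfD.
- by apply: laurent_eq (laurentM (laurentC d) (hu k)) => t t0; rewrite cfZ.
- by apply: laurent_eq (laurentM laurentX (hu k)) => t t0; rewrite coef_xl.
have lA : laurent Ac.
  exact: laurentD (laurentM (laurentC a) laurentV) (laurentC c).
have lB : laurent Bc.
  apply: laurent_eq (laurentM (laurentC (1 - r ^+ 2)^-1) laurentV) => t t0.
  by rewrite /Bc invfM.
apply: laurent_eq (laurentD (laurentM lA (laurent_shift (-1) (hu (k + 1))))
  (laurentM lB (laurent_shift 1 (hu (k - 1))))) => t t0.
by rewrite coef_el.
Qed.

(** * Twisted convolution formula for products *)

Definition zsum (d : nat) (f : int -> F) := \sum_(i < d.*2.+1) f (i%:Z - d%:Z).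

Lemma zsum_shift d f : f (- d%:Z) = 0 -> f (d%:Z + 1) = 0 ->
  zsum d (fun i => f (i + 1)) = zsum d f.
Proof.
move=> f1 f2; rewrite /zsum big_ord_recr big_ord_recl /=.
rewrite (_ : d.*2%:Z - d%:Z + 1 = d%:Z + 1) ?f2; last by lia.
rewrite sub0r f1 addr0 add0r; apply: eq_bigr => i _; congr f.
rewrite /bump /=; lia.
Qed.

(** Moving y^i past a coefficient of [v] shifts its argument by r^i. The formula is stated for all
    large windows so that the bounds of two summands can be merged and the window later enlarged. *)
Lemma coefM u v : exists d0 : nat, forall d : nat, (d0 <= d)%N ->
  (forall k (t : F), t != 0 -> (d < `|k|)%N -> coef u k t = 0) /\
  (forall k (t : F), t != 0 ->
    coef (u * v) k t = zsum d (fun i => coef u i t * coef v (k - i) (sh i t))).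
Proof.
elim/gen: u => [|u w [m hu] [n hw]|d u [n hu]|u [n hu]|u [n hu]].
- exists 0%N => d _; split=> k t t0; first by rewrite cf1 //; case: eqP => // ->.
  rewrite /zsum (bigD1 (inord d)) //= inordK; last by lia.
  rewrite subrr cf1 // mul1r mul1r subr0 rshift0 big1 ?addr0 // => i id.
  rewrite cf1 // (_ : (_ == 0) = false) ?mul0r //.
  apply: contraNF id => /eqP id; apply/eqP/val_inj; rewrite /= inordK; lia.
- exists (maxn m n) => d; rewrite geq_max => /andP [/hu [u1 u2] /hw [w1 w2]].
  split=> k t t0; first by move=> kd; rewrite cfD u1 ?w1 ?addr0.
  rewrite mulrDl cfD u2 // w2 // -big_split /=.
  by apply: eq_bigr => i _; rewrite cfD mulrDl.
- exists n => m /hu [u1 u2]; split=> k t t0; first by move=> /u1 h; rewrite cfZ h ?mulr0.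
  rewrite -scalerAl cfZ u2 // mulr_sumr; apply: eq_bigr => i _.
  by rewrite cfZ mulrA.
- exists n => m /hu [u1 u2]; split=> k t t0; first by move=> /u1 h; rewrite coef_xl // h ?mulr0.
  rewrite -mulrA coef_xl // u2 // mulr_sumr; apply: eq_bigr => i _.
  by rewrite coef_xl // mulrA.
(* Multiplication by [e] shifts degrees by one either way; the extra unit makes the boundary terms
   in [zsum_shift] vanish. *)
exists n.+1 => d nd; have [u1 _] := hu n (leqnn n).
have [_ u2] := hu d (ltnW nd).
split=> k t t0; first by move=> kd; rewrite coef_el // !u1 ?rshift_neq0 ?mulr0 ?addr0 //; lia.
rewrite -mulrA coef_el // !u2 ?rshift_neq0 //.
have st1 := rshift_neq0 r_neq0 (-1) t0; have st2 := rshift_neq0 r_neq0 1 t0.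
have -> : zsum d (fun i => coef u i (sh (-1) t) * coef v (k + 1 - i) (sh i (sh (-1) t)))
    = zsum d (fun i => coef u (i + 1) (sh (-1) t) * coef v (k - i) (sh i t)).
  rewrite -zsum_shift ?u1 ?mul0r //; [|lia..].
  apply: eq_bigr => i _; rewrite rshiftA // addrK.
  by congr (_ * coef v _ _); lia.
have <- : zsum d (fun i => coef u (i - 1) (sh 1 t) * coef v (k - i) (sh i t))
    = zsum d (fun i => coef u i (sh 1 t) * coef v (k - 1 - i) (sh i (sh 1 t))).
  rewrite -zsum_shift ?u1 ?mul0r //; [|lia..].
  apply: eq_bigr => i _; rewrite rshiftA // addrK.
  by congr (_ * coef v _ _); lia.
rewrite !mulr_sumr -big_split; apply: eq_bigr => i _ /=.
by rewrite coef_el // [RHS]mulrDl !mulrA.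
Qed.

Lemma coefM_single u v k h :
  (forall i (t : F), t != 0 -> i != h -> coef u i t * coef v (k - i) (sh i t) = 0) ->
  forall t : F, t != 0 -> coef (u * v) k t = coef u h t * coef v (k - h) (sh h t).
Proof.
move=> hi t t0; have [d0 hd] := coefM u v.
(* The window is enlarged so as to contain [h]. *)
have [_ -> //] := hd (maxn d0 `|h|%N) (leq_maxl _ _).
have := leq_maxr d0 `|h|%N; set d := maxn _ _ => dh.
have hn : (absz (h + d%:Z)%R < d.*2.+1)%N by lia.
have hE : (absz (h + d%:Z))%:Z - d%:Z = h by lia.
rewrite /zsum (bigD1 (Ordinal hn)) //= hE big1 ?addr0 // => i ihn.
by apply: hi => //; apply: contra_neq ihn => ih; apply/val_inj => /=; lia.
Qed.

(** * Extreme degrees of a product *)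

Lemma ex_max (S : int -> Prop) (d : nat) : (forall k, S k -> (`|k| <= d)%N) ->
  (exists k, S k) -> exists h, S h /\ forall k, S k -> k <= h.
Proof.
move=> Sd [k0 Sk0].
pose T (n : nat) := `[< S (n%:Z - d%:Z) >].
have T0 : exists n, T n.
  have := Sd _ Sk0 => ?; exists (absz (k0 + d%:Z)); apply/asboolP.
  by rewrite (_ : _%:Z - _ = k0) //; lia.
have Tb n : T n -> (n <= d.*2)%N by move=> /asboolP /Sd; lia.
case: (ex_maxnP T0 Tb) => h /asboolP Th maxh; exists (h%:Z - d%:Z); split=> // k Sk.
have kd := Sd k Sk.
have : T (absz (k + d%:Z)) by apply/asboolP; rewrite (_ : _%:Z - _ = k) //; lia.
by move/maxh; lia.
Qed.

Definition occurs u k := exists t : F, t != 0 /\ coef u k t != 0.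

Lemma occursPn u k t : t != 0 -> ~ occurs u k -> coef u k t = 0.
Proof. by move=> t0 h; apply: contrapT => /eqP ut; apply: h; exists t. Qed.

Lemma occurs_ex u : u <> 0 -> exists k, occurs u k.
Proof. by move=> /coef_neq0 [k [t h]]; exists k, t. Qed.

Lemma occurs_bound u : exists d : nat, forall k, occurs u k -> (`|k| <= d)%N.
Proof.
have [n /nf_supp [h1 h2]] := nf_ex u; exists n => k [t [t0 ut]].
have k1 : ~ (n%:Z < k) by move=> kn; rewrite h1 ?eqxx in ut.
have k2 : ~ (k < 1 - n%:Z) by move=> kn; rewrite h2 ?eqxx in ut.
lia.
Qed.

Lemma occurs_max u : u <> 0 -> exists h, occurs u h /\ supp_le u h.
Proof.
move=> u0; have [d hd] := occurs_bound u.
have [h [uh hh]] := ex_max hd (occurs_ex u0); exists h; split=> // k t t0 hk.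
by apply: occursPn => // /hh; lia.
Qed.

Lemma occurs_min u : u <> 0 -> exists l, occurs u l /\ supp_ge u l.
Proof.
move=> u0; have [d hd] := occurs_bound u.
have [||l [ul hl]] := @ex_max (fun k => occurs u (- k)) d.
- by move=> k /hd; lia.
- by have [k uk] := occurs_ex u0; exists (- k); rewrite opprK.
exists (- l); split=> // k t t0 hk.
by apply: occursPn => // uk; have := hl (- k); rewrite opprK => /(_ uk); lia.
Qed.

(** A single pair of degrees contributes to h + k, and the product of two nonzero Laurent functions
    is nonzero by [laurent_dom]. *)
Lemma occursM u v h k : occurs u h -> occurs v k ->
  (forall i, i != h -> occurs u i -> ~ occurs v (h + k - i)) ->
  occurs (u * v) (h + k).
Proof.
move=> uh [s [s0 vs]] uniq_h; apply: contrapT => huv.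
have lv := laurent_shift h (laurent_coef v k).
have uv0 (t : F) : t != 0 -> coef u h t * coef v k (sh h t) = 0.
  move=> t0; rewrite -(occursPn t0 huv) (coefM_single _ t0 (h := h)).
    by rewrite addrAC subrr add0r.
  move=> i z z0 ih; have st := rshift_neq0 r_neq0 i z0.
  have [ui|/(occursPn z0) -> //] := pselect (occurs u i); last by rewrite mul0r.
  by rewrite (occursPn st (uniq_h _ ih ui)) mulr0.
(* The point is shifted back by r^-h so that the twisted coefficient of [v] is evaluated at [s]. *)
have := laurent_dom (laurent_coef u h) lv uv0 uh (rshift_neq0 r_neq0 (- h) s0).
by rewrite rshiftA // subrr rshift0 => /eqP; rewrite (negPf vs).
Qed.

Lemma supp_le_occurs u h k : supp_le u h -> occurs u k -> k <= h.
Proof. by move=> hu [t [t0 ut]]; rewrite leNgt; apply: contraNN ut => /hu ->. Qed.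

Lemma supp_ge_occurs u h k : supp_ge u h -> occurs u k -> h <= k.
Proof. by move=> hu [t [t0 ut]]; rewrite leNgt; apply: contraNN ut => /hu ->. Qed.

Lemma occursM_top u v h k : occurs u h -> supp_le u h -> occurs v k -> supp_le v k ->
  occurs (u * v) (h + k).
Proof.
move=> uh /supp_le_occurs hu vk /supp_le_occurs hv; apply: occursM => // i ih.
by move=> /hu ui /hv; lia.
Qed.

Lemma occursM_low u v h k : occurs u h -> supp_ge u h -> occurs v k -> supp_ge v k ->
  occurs (u * v) (h + k).
Proof.
move=> uh /supp_ge_occurs hu vk /supp_ge_occurs hv; apply: occursM => // i ih.
by move=> /hu ui /hv; lia.
Qed.

(** * Units are scalars *)

Lemma occurs1 k : occurs 1 k -> k = 0.
Proof. by move=> [t [t0]]; rewrite cf1 //; case: (k =P 0) => // _; rewrite eqxx. Qed.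

Lemma one_neq0 : 1 <> 0 :> A.
Proof. by apply/eqP; rewrite oner_eq0. Qed.

(* Extremal degrees add up under multiplication, so both factors of 1 have
   equal extremal degrees. *)
Lemma inv_homogeneous u v : u * v = 1 -> exists h,
  (forall i, occurs u i -> i = h) /\ (forall i, occurs v i -> i = - h).
Proof.
move=> uv.
have u0 : u <> 0 by move=> u0; apply: one_neq0; rewrite -uv u0 mul0r.
have v0 : v <> 0 by move=> v0; apply: one_neq0; rewrite -uv v0 mulr0.
have [h [uh hu]] := occurs_max u0; have [k [vk hv]] := occurs_max v0.
have [l [ul lu]] := occurs_min u0; have [m [vm mv]] := occurs_min v0.
have := occursM_top uh hu vk hv; rewrite uv => /occurs1 hk.
have := occursM_low ul lu vm mv; rewrite uv => /occurs1 lm.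
have lh := supp_le_occurs hu ul; have mk := supp_le_occurs hv vm.
exists h; split=> i.
  by move=> ui; have := supp_le_occurs hu ui; have := supp_ge_occurs lu ui; lia.
by move=> vi; have := supp_le_occurs hv vi; have := supp_ge_occurs mv vi; lia.
Qed.

Lemma inv_coef u v h : u * v = 1 -> (forall i, occurs u i -> i = h) ->
  forall t : F, t != 0 -> coef u h t * coef v (- h) (sh h t) = 1.
Proof.
move=> uv hu t t0; have := cf1 0 t0; rewrite -uv (coefM_single _ t0 (h := h)) ?sub0r //.
move=> i z z0 ih; rewrite (occursPn z0) ?mul0r // => /hu ihE.
by rewrite ihE eqxx in ih.
Qed.

(* The bottom coefficient of a normal form of positive length vanishes at the
   zero of [Ac]. *)
Lemma nowhere_zero_hx u h : h <= 0 -> (forall i, occurs u i -> i = h) ->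
  (forall t : F, t != 0 -> coef u h t != 0) -> h = 0 /\ exists P, u = hx P.
Proof.
move=> h0 hu unz; have [n nu] := nf_ex u; elim: n nu => [|n IHn].
  by move=> u0; have := unz 1 (oner_neq0 _); rewrite u0 cf0 eqxx.
move=> [u' [P [Q [nu' def_u]]]].
have Q0 : Q = 0.
  apply: (@mul_prod_Bc_eq0 n) => t t0; rewrite -(nf_top P Q t0 nu') -def_u.
  by apply: occursPn => // /hu; lia.
have lowE (t : F) : t != 0 -> coef u (- n%:Z) t = P.[t] * \prod_(i < n) Ac (sh (- i%:Z) t).
  by move=> t0; rewrite -(nf_low P Q t0 nu') -def_u.
(* If the bottom degree -n differs from [h], then [P] vanishes as well and a shorter normal form
   remains. *)
have [nh|nh] := eqVneq (- n%:Z) h; last first.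
  have P0 : P = 0.
    apply: (@mul_prod_Ac_eq0 n) => t t0; rewrite -lowE //.
    by apply: occursPn => // /hu /eqP; rewrite (negPf nh).
  apply: IHn; move: def_u nu'; rewrite P0 Q0 hx0 mul0r addr0 mul0r addr0.
  by move=> ->.
case: n => [|n] in nu' def_u lowE nh IHn *.
  split; first by rewrite -nh.
  by exists P; rewrite def_u nu' add0r Q0 hx0 mul0r addr0 mulr1.
have t0 : - a / c != 0 by rewrite mulf_neq0 ?oppr_eq0 ?invr_eq0.
have := unz _ t0; rewrite -nh lowE // big_ord_recl /= oppr0 rshift0.
have -> : Ac (- a / c) = 0 by rewrite /Ac; field; rewrite ?oppr_eq0 a_neq0 c_neq0.
by rewrite mul0r mulr0 eqxx.
Qed.

Lemma inv_scalar (u : A) : invertible u -> exists2 d : F, d != 0 & u = d *: 1.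
Proof.
move=> [v [uv vu]].
have [h [hu hv]] := inv_homogeneous uv.
have unz (t : F) : t != 0 -> coef u h t != 0.
  move=> t0; have := inv_coef uv hu t0 => uv1.
  by apply/eqP => u0; have /eqP := uv1; rewrite u0 mul0r eq_sym oner_eq0.
have vnz (t : F) : t != 0 -> coef v (- h) t != 0.
  move=> t0; have := inv_coef vu hv t0 => uv1.
  by apply/eqP => u0; have /eqP := uv1; rewrite u0 mul0r eq_sym oner_eq0.
(* One of [u], [v] has nonpositive degree; [nowhere_zero_hx] for that one forces degree zero. *)
have h0 : h = 0.
  have [hle|hge] := lerP h 0.
    by have [] := nowhere_zero_hx hle hu unz.
  have hn : - h <= 0 by rewrite oppr_le0 ltW.
  by have [/eqP] := nowhere_zero_hx hn hv vnz; rewrite oppr_eq0 => /eqP.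
rewrite h0 oppr0 in hu hv unz vnz.
have [_ [P uP]] := nowhere_zero_hx (lexx 0) hu unz.
have [_ [Q vQ]] := nowhere_zero_hx (lexx 0) hv vnz.
have PQ : P * Q = 1.
  apply/eqP; rewrite -subr_eq0; apply/eqP; apply: (poly_eq0_nz r_neq0 r_nroot) => t t0.
  rewrite hornerD hornerN hornerC hornerM; apply/eqP; rewrite subr_eq0; apply/eqP.
  by have := inv_coef uv hu t0; rewrite oppr0 rshift0 uP vQ !coef_hx // !mulr1.
have : P \is a GRing.unit by apply/unitrPr; exists Q.
rewrite poly_unitE => /andP [/size_poly1P [d d0 Pd] _].
by exists d => //; rewrite uP Pd hxC.
Qed.

(** * Nonzero two-sided ideals contain 1 *)

Section Ideal.
Variable I : set A.
Hypothesis idI : two_sided_ideal I.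

Let I0 : I 0. Proof. by case: idI. Qed.
Let ID u v : I u -> I v -> I (u + v). Proof. by case: idI => _ h _ _; apply: h. Qed.
Let IMl u v : I v -> I (u * v). Proof. by case: idI => _ _ h _; apply: h. Qed.
Let IMr u v : I u -> I (u * v). Proof. by case: idI => _ _ _ h; apply: h. Qed.
Let IZ (d : F) u : I u -> I (d *: u). Proof. by rewrite -mulr_algl; apply: IMl. Qed.
Let IB u v : I u -> I v -> I (u - v).
Proof. by move=> Iu Iv; rewrite -scaleN1r; apply: ID => //; apply: IZ. Qed.
Let IVZ (d : F) u : d != 0 -> I (d *: u) -> I u.
Proof. by move=> d0 /(IZ d^-1); rewrite scalerA mulVf // scale1r. Qed.

Definition homogeneous u k := forall i, occurs u i -> i = k.

Lemma homogeneous_coef u k i (t : F) : homogeneous u k -> t != 0 -> i != k -> coef u i t = 0.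
Proof. by move=> hu t0 ik; apply: occursPn => // /hu /eqP; apply/negP. Qed.

(** A twisted commutator with [x] multiplies the coefficient of degree j by t (1 - r^(j-k)), which
    kills degree k and no other. Taking k at the top of the window shortens it. *)
Lemma ideal_homogeneous n u lo : I u -> u <> 0 ->
  (forall k, occurs u k -> lo <= k < lo + n%:Z) ->
  exists v k, [/\ I v, v <> 0 & homogeneous v k].
Proof.
elim: n u => [|n IHn] u Iu u0 hu.
  by have [k /hu] := occurs_ex u0; lia.
pose k := lo + n%:Z; pose v := x * u - (r ^ k)^-1 *: (u * x).
have vE j (t : F) : t != 0 -> coef v j t = t * (1 - r ^ (j - k)) * coef u j t.
  move=> t0; rewrite cfB cfZ coef_xl // coef_xr // expfzDr // -invr_expz /rshift; ring.
have [v0|v0] := pselect (v = 0).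
  exists u, k; split=> // i [t [t0 ut]].
  have := vE i t t0; rewrite v0 cf0 => /esym /eqP.
  rewrite !mulf_eq0 (negPf t0) (negPf ut) orbF /= subr_eq0 eq_sym => rik.
  apply/eqP; rewrite -subr_eq0; apply: contraTT rik; exact: exprz_neq1.
apply: (IHn v) => //; first by apply: IB; [apply: IMl|apply: IZ; apply: IMr].
move=> i [t [t0]]; rewrite vE // !mulf_eq0 !negb_or => /andP [/andP [_ h] ut].
have := hu i (ex_intro _ t (conj t0 ut)).
have : i != k by apply: contraNneq h => ->; rewrite subrr subrr.
rewrite /k; lia.
Qed.

Lemma coef_monomial s n i (t : F) : t != 0 ->
  coef (x ^+ s * y ^+ n) i t = t ^+ s * (i == n%:Z)%:R.
Proof. by move=> t0; rewrite coef_xnl // -[y ^+ n]mul1r coef_ynr // cf1 // subr_eq0. Qed.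

(** Induction on the numerator [P] of the only coefficient: a twisted commutator with [y] compares
    P(r t) with r^s P(t) and so removes the leading term. *)
Lemma ideal_monomial n (P : {poly F}) v k m : (size P <= n)%N -> I v -> v <> 0 ->
  homogeneous v k -> (forall t : F, t != 0 -> t ^+ m * coef v k t = P.[t]) ->
  exists s j, I (x ^+ s * y ^+ j).
Proof.
elim: n P v k => [|n IHn] P v k.
  rewrite size_poly_leq0 => /eqP -> _ v0 hv hP; case: v0; apply: coef_inj => i t t0.
  have [->|ik] := eqVneq i k; last by rewrite (homogeneous_coef hv) // cf0.
  have /eqP := hP t t0; rewrite horner0 mulf_eq0 expf_eq0 (negPf t0) andbF cf0.
  by move=> /eqP.
move=> sP Iv v0 hv hP; pose s := (size P).-1.
have vE j (t : F) : t != 0 ->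
    coef (y * v - (r ^+ s / r ^+ m) *: (v * y)) j t
    = coef v (j - 1) (sh 1 t) - r ^+ s / r ^+ m * coef v (j - 1) t.
  by move=> t0; rewrite cfB cfZ coef_yl // coef_yr.
set v' := y * v - _ in vE.
(* Numerator of the coefficient of [v'] in degree k + 1; the factor r^i - r^s vanishes at the
   leading index i = s and at no smaller one. *)
pose P' := \poly_(i < s) ((r ^+ i - r ^+ s) / r ^+ m * P`_i).
have sPE : size P = s.+1.
  rewrite /s prednK // lt0n size_poly_eq0; apply: contra_notN v0 => /eqP P0.
  apply: coef_inj => i t t0.
  have [->|ik] := eqVneq i k; last by rewrite (homogeneous_coef hv) // cf0.
  have /eqP := hP t t0; rewrite P0 horner0 mulf_eq0 expf_eq0 (negPf t0) andbF cf0.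
  by move=> /eqP.
have hP' (t : F) : t != 0 -> t ^+ m * coef v' (k + 1) t = P'.[t].
  move=> t0; rewrite vE // addrK mulrBr mulrCA hP //.
  have -> : t ^+ m * coef v k (sh 1 t) = (r ^+ m)^-1 * P.[sh 1 t].
    rewrite -hP ?rshift_neq0 // /rshift expr1z exprMn -mulrA mulKf //.
    by rewrite expf_neq0.
  rewrite horner_poly !horner_coef sPE !big_ord_recr /= !mulrDr !mulr_sumr opprD.
  rewrite addrACA -sumrB [X in _ + X](_ : _ = 0) ?addr0; last first.
    by rewrite /rshift expr1z exprMn; ring.
  by apply: eq_bigr => i _; rewrite /rshift expr1z exprMn; ring.
have [v'0|v'0] := pselect (v' = 0); last first.
  apply: (IHn P' v' (k + 1)) => //.
  - by apply: leq_trans (size_poly _ _) _; rewrite sPE in sP.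
  - by apply: IB; [apply: IMl|apply: IZ; apply: IMr].
  move=> i [t [t0]]; rewrite vE // => h; apply/eqP; apply: contraNT h => ik.
  rewrite !(homogeneous_coef hv) ?rshift_neq0 // ?mulr0 ?subr0 //;
  by apply: contraNneq ik => <-; rewrite subrK.
(* When the commutator vanishes, [P] is reduced to its leading monomial. *)
have P'0 : P' = 0.
  by apply: (poly_eq0_nz r_neq0 r_nroot) => t t0; rewrite -hP' // v'0 cf0 mulr0.
have P0 i : (i < s)%N -> P`_i = 0.
  move=> lis; have := congr1 (fun Q : {poly F} => Q`_i) P'0.
  rewrite coef_poly lis coef0 => /eqP; rewrite !mulf_eq0 invr_eq0 expf_eq0 (negPf r_neq0) andbF orbF.
  case/orP => [|/eqP //]; rewrite subr_eq0 => /eqP ris.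
  have /eqP [] : r ^+ (s - i) != 1 by rewrite r_nroot // subn_gt0.
  by apply: (mulIf (expf_neq0 i r_neq0)); rewrite -exprD mul1r subnK // ltnW.
have PE (t : F) : P.[t] = P`_s * t ^+ s.
  rewrite horner_coef sPE big_ord_recr /= big1 ?add0r // => i _.
  by rewrite P0 ?mul0r.
have Ps0 : P`_s != 0 by rewrite -/(lead_coef P) lead_coef_eq0 -size_poly_eq0 sPE.
(* Multiplying by y^|k| makes the degree nonnegative, and x^m clears the denominator, so the result
   is a genuine monomial of [A]. *)
pose j := `|k|%N.
have [p kp] : exists p : nat, k + j%:Z = p%:Z by exists (absz (k + j%:Z)); rewrite /j; lia.
exists s, p; apply: (IVZ Ps0).
suff -> : P`_s *: (x ^+ s * y ^+ p) = x ^+ m * (v * y ^+ j) by apply: IMl; apply: IMr.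
apply: coef_inj => i t t0; rewrite cfZ coef_monomial // coef_xnl // coef_ynr //.
have [->|ip] := eqVneq i p%:Z.
  by rewrite mulr1 -kp addrK hP // PE.
rewrite (homogeneous_coef hv) ?mulr0 //; apply: contraNneq ip => ij.
by rewrite -kp -ij subrK.
Qed.

Lemma yxn n : y * x ^+ n = r ^+ n *: (x ^+ n * y).
Proof.
elim: n => [|n IHn]; first by rewrite mulr1 mul1r scale1r.
rewrite (exprSr x) mulrA IHn -scalerAl -!mulrA rel_yx -scalerAr scalerA.
by rewrite -(exprSr r).
Qed.

Lemma xn_e n : exists2 d : F, d != 0 &
  x ^+ n.+1 * e = r ^+ n.+1 *: (e * x ^+ n.+1) + d *: (x ^+ n * y).
Proof.
(* A geometric sum collecting the [y] produced at each passage of [e] past [x]; r^2 - 1 times it is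
   r^(2n+2) - 1, which is nonzero. *)
pose d n : F := \sum_(i < n.+1) (r ^+ 2) ^+ i; exists (d n).
  have : (r ^+ 2 - 1) * d n != 0 by rewrite -subrX1 subr_eq0 -exprM r_nroot.
  by rewrite mulf_eq0 negb_or => /andP [].
have xe : x * e = y + r *: (e * x) by rewrite def_y subrK.
elim: n => [|n IHn].
  by rewrite /d big_ord1 !expr0 !mul1r scale1r !expr1 addrC.
rewrite exprS -mulrA IHn mulrDr -!scalerAr !mulrA xe mulrDl scalerDr yxn.
rewrite -scalerAl !scalerA -!mulrA -!exprS -exprSr (mulrA x) -(exprS x).
rewrite addrAC -scalerDl addrC.
congr (_ + _ *: _).
rewrite /d [in RHS]big_ord_recr /= addrC; congr (_ + _).
by rewrite -exprD -exprM; congr (_ ^+ _); lia.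
Qed.

Lemma e_yn n : exists2 d : F, d != 0 &
  e * y ^+ n.+1 = r ^+ n.+1 *: (y ^+ n.+1 * e) + d *: y ^+ n.
Proof.
(* Each passage of [e] past [y] adds [al] times a power of [r]; r - 1 times the total is al (r^(n+1)
   - 1), which is nonzero. *)
pose d n : F := al * \sum_(i < n.+1) r ^+ i; exists (d n).
  have : (r - 1) * d n != 0.
    by rewrite mulrCA -subrX1 mulf_neq0 // subr_eq0 r_nroot.
  by rewrite mulf_eq0 negb_or => /andP [].
elim: n => [|n IHn].
  by rewrite /d big_ord1 !expr0 mulr1 !expr1 rel_ey.
rewrite (exprS y) mulrA rel_ey mulrDl -!scalerAl mul1r -!(mulrA y) IHn mulrDr -!scalerAr.
rewrite scalerDr !scalerA -!exprS -addrA -scalerDl; congr (_ + _ *: _).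
rewrite /d mulrCA -[X in _ + X]mulr1 -mulrDr; congr (_ * _); rewrite [in RHS]big_ord_recl addrC mulr_sumr.
by congr (_ + _); apply: eq_bigr => i _; rewrite -exprS.
Qed.

(** Expand x^(i+1) e y^(j+1) in two ways. Moving x^(i+1) past [e] shows that it lies in the ideal;
    moving [e] past y^(j+1) exhibits x^(i+1) y^j. A factor [y] is thus traded for an [x]. *)
Lemma ideal_lower_y i j : I (x ^+ i * y ^+ j.+1) -> I (x ^+ i.+1 * y ^+ j).
Proof.
move=> IM; have [d d0 xe] := xn_e i; have [g g0 ey] := e_yn j.
apply: (IVZ g0).
have -> : g *: (x ^+ i.+1 * y ^+ j) = x ^+ i.+1 * e * y ^+ j.+1
    - r ^+ j.+1 *: (x * (x ^+ i * y ^+ j.+1) * e).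
  rewrite -mulrA ey mulrDr -!scalerAr !mulrA -!exprS addrAC subrr add0r //.
apply: IB; last by apply: IZ; apply: IMr; apply: IMl.
rewrite xe mulrDl -!scalerAl; apply: ID; apply: IZ.
  by rewrite exprS -!mulrA; apply: IMl; apply: IMl.
by rewrite -mulrA -exprS exprSr mulrA; apply: IMr.
Qed.

(** Commuting with [e] gives x^i y. Multiplying by [y] and applying [rel_yy] gives b0 x^i modulo the
    ideal, since the other two terms contain x^(i+1). *)
Lemma ideal_lower_x i : I (x ^+ i.+1) -> I (x ^+ i).
Proof.
move=> Ix; have [d d0 xe] := xn_e i.
have Ixy : I (x ^+ i * y).
  apply: (IVZ d0).
  have -> : d *: (x ^+ i * y) = x ^+ i.+1 * e - r ^+ i.+1 *: (e * x ^+ i.+1).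
    by rewrite xe addrAC subrr add0r.
  by apply: IB; [apply: IMr|apply: IZ; apply: IMl].
apply: (IVZ b0_neq0).
have -> : b0 *: x ^+ i = x ^+ i * y * y - (b1 *: (x ^+ i.+1 * y * e) + b2 *: x ^+ i.+1).
  by rewrite -mulrA rel_yy -addrA !mulrDr -!scalerAr mulr1 !mulrA -exprSr addrK.
by apply: IB; [apply: IMr|apply: ID; apply: IZ => //; rewrite -mulrA; apply: IMr].
Qed.

Lemma ideal_full u : I u -> u <> 0 -> I 1.
Proof.
move=> Iu u0; have [d hd] := occurs_bound u.
have [|v [k [Iv v0 hv]]] := @ideal_homogeneous d.*2.+1 u (- d%:Z) Iu u0.
  by move=> i /hd; lia.
have [m [P hP]] := laurent_coef v k.
have [s [j]] := ideal_monomial (leqnn _) Iv v0 hv hP.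
elim: j s => [|j IHj] s; last by move/ideal_lower_y/IHj.
by rewrite mulr1; elim: s => // s IHs /ideal_lower_x/IHs.
Qed.

End Ideal.

(** * Simplicity and centre *)

Lemma algebra_simple : simple_algebra A.
Proof.
split; first exact: one_neq0.
move=> I idI; have [I0|nI0] := pselect (forall u, I u -> u = 0).
  by left; apply/seteqP; split=> u /=; [exact: I0|move=> ->; case: idI].
right; apply/seteqP; split=> // u _.
have [v /not_implyP [Iv v0]] : exists v, ~ (I v -> v = 0) by apply/existsNP.
have [_ _ hl _] := idI; rewrite -[u]mulr1; apply: hl; exact: ideal_full Iv v0.
Qed.

Lemma central_scalar u : center A u -> exists d : F, u = d *: 1.
Proof.
move=> uC; have [->|/eqP u0] := eqVneq u 0; first by exists 0; rewrite scale0r.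
have [_ simpleA] := algebra_simple.
(* The left multiples of [u] form a two-sided ideal because [u] is central. *)
have [|I0|IT] := simpleA [set v | exists w, v = w * u].
- split=> [|_ _ [v ->] [w ->]|v _ [w ->]|v _ [w ->]].
  + by exists 0; rewrite mul0r.
  + by exists (v + w); rewrite mulrDl.
  + by exists (v * w); rewrite mulrA.
  + by exists (w * v); rewrite -!mulrA uC.
- by case: u0; have : [set 0] u by rewrite -I0; exists 1; rewrite mul1r.
- have [w uw] : [set v | exists w, v = w * u] 1 by rewrite IT.
  have [|d _ ->] := @inv_scalar u; last by exists d.
  by exists w; rewrite uC -uw.
Qed.

Lemma center_scalars : center A = [set d *: (1 : A) | d in [set: F]].
Proof.
apply/seteqP; split=> [u /central_scalar [d ->]|_ [d _ <-] v] /=; first by exists d.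
by rewrite -scalerAl -scalerAr mul1r mulr1.
Qed.

Lemma laurent_coef_properties :
  [/\ simple_algebra A,
      forall u : A, invertible u -> exists2 d : F, d != 0 & u = d *: 1
    & center A = [set d *: (1 : A) | d in [set: F]]].
Proof. by split; [exact: algebra_simple|exact: inv_scalar|exact: center_scalars]. Qed.

End LaurentCoefficients.

(** The scaling [sc] is a parameter so that the notion applies to a quotient whose unit is not yet
    known to be nonzero, hence which is not yet an [algType]. *)
Definition is_action (K : pzRingType) (W : lmodType K) (A : pzRingType)
    (sc : K -> A -> A) (act : A -> W -> W) : Prop :=
  [/\ forall w, act 1 w = w, forall u v w, act (u * v) w = act u (act v w),
      forall u v w, act (u + v) w = act u w + act v w
    & forall d u w, act (sc d u) w = d *: act u w].

(** * Actions of free algebras *)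

Section FreeAction.
Variables (K : comNzRingType) (I : choiceType) (W : lmodType K).
Variable op : I -> {linear W -> W}.

Definition word_act (s : seq I) (w : W) : W := foldr (fun i => op i) w s.

Lemma word_act_linear s : linear (word_act s).
Proof. by move=> d u v; elim: s => //= i s ->; rewrite linearP. Qed.

HB.instance Definition _ s :=
  GRing.isLinear.Build K W W *:%R (word_act s) (word_act_linear s).

Definition free_act (f : free_alg K I) (w : W) : W :=
  \sum_(m <- msupp (f : {malg K[{fmonom I}]})) mcoeff m f *: word_act m w.

Lemma free_actEw (d : {fset {fmonom I}}) (f : {malg K[{fmonom I}]}) w :
  fsubset (msupp f) d -> free_act f w = \sum_(m <- d) mcoeff m f *: word_act m w.
Proof.
move=> le; rewrite /free_act (big_fset_incl _ le) // => m _ /mcoeff_outdom ->.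
by rewrite scale0r.
Qed.

Lemma free_actU (c : K) (m : {fmonom I}) w :
  free_act (<< c *g m >> : {malg K[{fmonom I}]}) w = c *: word_act m w.
Proof. by rewrite (free_actEw _ msuppU_le) big_seq_fset1 mcoeffUU. Qed.

Lemma free_actD (f g : free_alg K I) w : free_act (f + g) w = free_act f w + free_act g w.
Proof.
rewrite (free_actEw _ (msuppD_le f g)) (free_actEw _ (fsubsetUl (msupp f) (msupp g))).
rewrite (free_actEw _ (fsubsetUr (msupp f) (msupp g))) -big_split /=.
by apply: eq_bigr => m _; rewrite mcoeffD scalerDl.
Qed.

Lemma free_act_action : is_action *:%R free_act.
Proof.
have act0 w : free_act 0 w = 0.
  by rewrite -[free_act 0 w](addrK (free_act 0 w)) -free_actD addr0 subrr.
split; last first.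
- move=> d f w; rewrite (free_actEw _ (msuppZ_le d f)) /free_act scaler_sumr.
  by apply: eq_bigr => m _; rewrite mcoeffZ scalerA.
- exact: free_actD.
- move=> f g w.
  have -> : f * g = \sum_(m <- msupp f) \sum_(n <- msupp g)
      (<< mcoeff m f * mcoeff n g *g mmul m n >> : {malg K[{fmonom I}]}).
    exact: malgME.
  have act_sum (J : Type) (s : seq J) (h : J -> free_alg K I) :
      free_act (\sum_(j <- s) h j) w = \sum_(j <- s) free_act (h j) w.
    by apply: (big_morph (free_act^~ w)) => // u v; apply: free_actD.
  rewrite act_sum; apply: eq_bigr => m _; rewrite act_sum linear_sum scaler_sumr.
  apply: eq_bigr => n _; rewrite free_actU linearZ scalerA; congr (_ *: _).
  by rewrite /word_act fmM foldr_cat.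
- by move=> w; rewrite (free_actU 1 mone) scale1r /word_act fm1.
Qed.

Lemma free_act_gen i w : free_act (free_gen K i) w = op i w.
Proof. by rewrite free_actU scale1r /word_act fmU. Qed.

End FreeAction.

Lemma free_alg_ind (K : comNzRingType) (I : choiceType) (P : free_alg K I -> Prop) :
  P 1 -> (forall u v, P u -> P v -> P (u + v)) -> (forall d u, P u -> P (d *: u)) ->
  (forall i u, P u -> P (free_gen K i * u)) -> forall u, P u.
Proof.
move=> P1 PD PZ PX u.
have P0 : P 0 by rewrite -(scale0r 1); apply: PZ.
rewrite (monalgE (u : {malg K[{fmonom I}]})); apply: (big_ind P) => // m _.
have -> : << mcoeff m u *g m >> = mcoeff m u *: (<< m >> : {malg K[{fmonom I}]}).
  by rewrite -mul_malgC malgM_def fgmulUU mulr1 mul1m.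
apply: PZ; rewrite -[m]fmK; elim: (m : seq I) => [|i s IHs].
  by rewrite -fmoneE.
have -> : (<< FMonom (i :: s) >> : free_alg K I) = free_gen K i * << FMonom s >>.
  rewrite /free_gen [RHS]malgM_def fgmulUU mulr1; congr << _ *g _ >>.
  by rewrite [RHS]fmmulE fmuE.
exact: PX.
Qed.

(** * Descent of actions to quotients *)

Section QuotAction.
Variables (K : pzRingType) (W : lmodType K) (A : algType K) (S : set A).
Variable act : A -> W -> W.
Hypothesis actP : is_action *:%R act.
Hypothesis actS : forall s, S s -> forall w, act s w = 0.

Definition quot_act (u : quot_alg S) : W -> W := act (repr u).

(** The elements acting by zero form a two-sided ideal containing [S], so the choice of
    representative is immaterial. *)
Lemma quot_act_pi a : quot_act (quot_pi S a) = act a.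
Proof.
have [act1 actM actD actZ] := actP.
have act0 w : act 0 w = 0 by rewrite -(scale0r 1) actZ scale0r.
have act_0 a' : act a' 0 = 0 by rewrite -(act0 0) -actM mulr0.
have actN u w : act (- u) w = - act u w by rewrite -[- u]scaleN1r actZ scaleN1r.
apply: funext => w; rewrite /quot_act; apply/esym/eqP; rewrite -subr_eq0.
rewrite -actN -actD; apply/eqP; move: w.
suff : [set u | forall w, act u w = 0] (a - repr (quot_pi S a)) by [].
apply: pi_quot_repr; last exact: actS.
split=> [//|u v hu hv w|u v hv w|u v hu w].
- by rewrite actD hu hv addr0.
- by rewrite actM hv act_0.
- by rewrite actM hu.
Qed.

Lemma quot_act_action : is_action (A := quot_alg S) *:%R quot_act.
Proof.
have [act1 actM actD actZ] := actP; split.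
- by move=> w; rewrite quot_act_pi act1.
- by elim/quotW=> u; elim/quotW=> v w; rewrite -rmorphM !quot_act_pi actM.
- by elim/quotW=> u; elim/quotW=> v w; rewrite -rmorphD !quot_act_pi actD.
- by move=> d; elim/quotW=> u w; rewrite -quot_piZ !quot_act_pi actZ.
Qed.

End QuotAction.

(** * The representation space *)

Section LaurentSpace.
Variables (F : fieldType) (r a c : F).
Hypothesis r_neq0 : r != 0.

(* Leaving out t = 0 keeps the divisions in [Ac] and [Bc] away from their junk
   values. *)
Definition nonzero := {t : F | t != 0}.

Definition nzshift (k : int) (t : nonzero) : nonzero :=
  exist _ (rshift r k (val t)) (rshift_neq0 r_neq0 k (valP t)).

Lemma nzshiftA k l t : nzshift k (nzshift l t) = nzshift (k + l) t.
Proof. by apply: val_inj; rewrite /= rshiftA. Qed.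

Lemma nzshift0 t : nzshift 0 t = t.
Proof. by apply: val_inj; rewrite /= rshift0. Qed.

(** A vector gives, for a degree k and a point t, the value at t of the coefficient of y^k; the
    operators below copy left multiplication by [x], [e] and [y]. *)
Definition laurent_space : Type := int * nonzero -> F^o.
HB.instance Definition _ := GRing.Lmodule.on laurent_space.

Definition op_x (w : laurent_space) : laurent_space := fun p => val p.2 * w p.
Definition op_e (w : laurent_space) : laurent_space := fun p =>
  Ac a c (val p.2) * w (p.1 + 1, nzshift (-1) p.2)
  + Bc r (val p.2) * w (p.1 - 1, nzshift 1 p.2).
Definition op_y (w : laurent_space) : laurent_space :=
  fun p => w (p.1 - 1, nzshift 1 p.2).

Lemma lspaceE d (u v : laurent_space) p : (d *: u + v) p = d * (u p : F) + v p.
Proof. by []. Qed.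

Lemma op_x_linear : linear op_x.
Proof. by move=> d u v; apply: funext => p; rewrite /op_x !lspaceE mulrDr mulrCA. Qed.

Lemma op_e_linear : linear op_e.
Proof.
move=> d u v; apply: funext => p; rewrite /op_e !lspaceE.
set w1 := u _; set w2 := u _; set w3 := v _; set w4 := v _.
move: w1 w2 w3 w4 => w1 w2 w3 w4.
rewrite !mulrDr !(mulrCA d) addrACA //.
Qed.

HB.instance Definition _ :=
  GRing.isLinear.Build F laurent_space laurent_space *:%R op_x op_x_linear.
HB.instance Definition _ :=
  GRing.isLinear.Build F laurent_space laurent_space *:%R op_e op_e_linear.

End LaurentSpace.

(** * Serre relations and central elements on the representation *)

Section SerreAction.
Variables (R : realType) (q a c : R[i]).
Hypothesis q_neq0 : q != 0.
Hypothesis r_neq0 : q ^+ 2 != 0.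
Hypothesis r2_neq1 : 1 - (q ^+ 2) ^+ 2 != 0.
Local Notation F := R[i].
Local Notation r := (q ^+ 2).
Local Notation W := (laurent_space F).
Local Notation X := (@op_x F).
Local Notation E := (op_e a c r_neq0).
Local Notation Y := (op_y r_neq0).
Variables (A : algType F) (act : A -> W -> W) (x1 x2 : A).
Hypothesis actP : is_action *:%R act.
Hypothesis act1 : forall w, act x1 w = X w.
Hypothesis act2 : forall w, act x2 w = E w.

Let actM u v w : act (u * v) w = act u (act v w). Proof. by case: actP. Qed.
Let actD u v w p : act (u + v) w p = act u w p + act v w p :> F.
Proof. by case: actP => _ _ -> _. Qed.
Let actZ d u w p : act (d *: u) w p = d * act u w p :> F.
Proof. by case: actP => _ _ _ ->. Qed.
Let actN u w p : act (- u) w p = - act u w p :> F.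
Proof. by rewrite -[- u]scaleN1r actZ mulN1r. Qed.

Let y := x1 * x2 - r *: (x2 * x1).
Let z := x2 * y - r *: (y * x2).

Lemma act_y w : act y w = Y w.
Proof.
apply: funext => -[k t]; rewrite actD actN actZ !actM !act1 !act2.
rewrite /op_x /op_e /op_y /= /Ac /Bc /rshift expr1z exprN1.
have t0 : sval t != 0 := valP t; set w1 := w _; set w2 := w _.
by field; rewrite t0 r2_neq1.
Qed.

(** In e y - r y e the [Bc] terms and the poles a/t of [Ac] cancel; only the constant [c]
    survives. *)
Lemma act_z w : act z w = ((1 - r) * c) *: w.
Proof.
apply: funext => -[k t].
rewrite actD actN actZ !actM !act2 !act_y /op_y /op_e /=.
rewrite !nzshiftA !(addrK, subrK) !nzshift0.
rewrite /Ac /Bc /rshift /= /rshift expr1z -[RHS]/((1 - r) * c * (w (k, t) : F)).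
have t0 : sval t != 0 := valP t; set w1 := w _; set w2 := w _.
by field; rewrite t0 q_neq0 r2_neq1.
Qed.

(** The first Serre expression equals x1 y - r^-1 y x1. *)
Lemma act_serre1 w : act (serre1 q x1 x2) w = 0.
Proof.
have xy : act (x1 * y - r^-1 *: (y * x1)) w = 0.
  apply: funext => -[k t]; rewrite actD actN actZ !actM !act_y !act1 /op_y /op_x /=.
  rewrite /rshift expr1z mulrA mulKf // subrr //.
apply: funext => p; rewrite -[RHS](congr1 (fun f : W => f p) xy) /serre1 /y.
rewrite !(mulrBl, mulrBr, scalerBr) -!(scalerAl, scalerAr) !expr2 !mulrA.
rewrite !(actD, actN, actZ).
set w1 := act _ w p; set w2 := act _ w p; set w3 := act _ w p.
by field; rewrite q_neq0.
Qed.

(** The second Serre expression is -r^-1 times the commutator of [x2] with [z], and [z] acts as a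
    scalar. *)
Lemma act_serre2 w : act (serre2 q x1 x2) w = 0.
Proof.
have yz : act (x2 * z - z * x2) w = 0.
  have [_ _ _ sZ] := actP.
  apply: funext => p; rewrite actD actN !actM !act_z !act2 linearZ; exact: subrr.
apply: funext => p.
have : - r^-1 * act (x2 * z - z * x2) w p = 0 by rewrite yz mulr0.
move=> yz0; rewrite -[RHS]yz0 /serre2 /z /y.
rewrite !(mulrBl, mulrBr, scalerBr) -!(scalerAl, scalerAr) !exprSr !expr0 !mul1r !mulrA.
rewrite !(actD, actN, actZ).
set w1 := act _ w p; set w2 := act _ w p; set w3 := act _ w p; set w4 := act _ w p.
by field; rewrite q_neq0.
Qed.

(** The [Bc] terms cancel in the second factor of the product, and the summand with [z] cancels the
    term in c t, leaving a multiple of [a]. *)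
Lemma act_z' w :
  act ((1 - q ^- 2) *: (y * (x1 * x2 - q ^- 2 *: (x2 * x1)) + (1 + q ^- 2) *: (z * x1))) w
  = ((1 - q ^- 2) * (1 - q ^- 4) * a) *: w.
Proof.
apply: funext => -[k t].
rewrite !(actZ, actD) !actM act_z !act_y !act1.
rewrite {1}/op_y !(actZ, actD, actN) !actM !act1 !act2 /op_e /op_x /=.
rewrite !nzshiftA !(addrK, subrK) !nzshift0.
have sZ d (u : W) p : (d *: u) p = d * (u p : F) by [].
rewrite !sZ /Ac /Bc /rshift expr1z exprN1 /=.
have t0 : sval t != 0 := valP t; set w1 := w _; set w2 := w _.
by field; rewrite t0 q_neq0 r2_neq1.
Qed.

End SerreAction.

(** * Algebra structure on the nontrivial quotient *)

Section NonzeroAab.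
Variables (R : realType) (q alpha beta : R[i]).
Local Notation C := R[i].

(* [1 != 0] depends on the hypotheses on q, so the [algType] structure of
   [Aab] is carried by an alias indexed by its proof. *)
Definition nz_Aab (nz : (1 : Aab q alpha beta) != 0) : Type := Aab q alpha beta.

Variable nz : (1 : Aab q alpha beta) != 0.
HB.instance Definition _ := GRing.PzRing.copy (nz_Aab nz) (Aab q alpha beta).
HB.instance Definition _ := GRing.Lmodule.copy (nz_Aab nz) (Aab q alpha beta).
HB.instance Definition _ := GRing.PzSemiRing_isNonZero.Build (nz_Aab nz) nz.
HB.instance Definition _ :=
  GRing.Lmodule_isLalgebra.Build C (nz_Aab nz) (@quot_scalerAl _ _ _).
HB.instance Definition _ :=
  GRing.Lalgebra_isAlgebra.Build C (nz_Aab nz) (@quot_scalerAr _ _ _).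

Definition nz_Aab_alg : algType C := nz_Aab nz.

End NonzeroAab.

(** * Relations derived from the presentation *)

Lemma serre1E (R : realType) (q : R[i]) (A : algType R[i]) (x1 x2 : A) : q != 0 ->
  serre1 q x1 x2 = x1 * (x1 * x2 - q ^+ 2 *: (x2 * x1))
    - (q ^+ 2)^-1 *: ((x1 * x2 - q ^+ 2 *: (x2 * x1)) * x1).
Proof.
move=> q0; rewrite mulrBr mulrBl scalerBr opprB -!scalerAl -!scalerAr scalerA.
rewrite mulVf ?expf_neq0 // scale1r /serre1 scalerDl opprD !expr2 !mulrA.
by rewrite addrA [RHS]addrA [RHS]addrAC.
Qed.

(** Eliminating [e * x] turns x e - r^-1 e x into (1 - r^-2) x e + r^-2 y, so the equation for
    [beta] is linear in y^2 and can be solved for it. *)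
Lemma e3_sqrE (F : fieldType) (r alpha beta : F) (A : algType F) (x e y : A) :
  r != 0 -> 1 - r^-1 != 0 ->
  y = x * e - r *: (e * x) -> x * y = r^-1 *: (y * x) ->
  beta *: 1 = (1 - r^-1) *: (y * (x * e - r^-1 *: (e * x))
    + (1 + r^-1) *: (alpha *: 1 * x)) ->
  y * y = (r ^+ 2 * beta / (1 - r^-1)) *: 1
    + (- (r * (r ^+ 2 - 1))) *: (x * y * e) + (- (r * (r + 1) * alpha)) *: x.
Proof.
move=> r0 r1 def_y xy.
have ex : e * x = r^-1 *: (x * e - y).
  by rewrite def_y opprB addrC subrK scalerA mulVf // scale1r.
have yxe : y * x * e = r *: (x * y * e).
  by rewrite xy -scalerAl scalerA divff // scale1r.
rewrite ex scalerA scalerBr opprB addrCA mulrDr -!scalerAr -scalerAl mul1r.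
rewrite mulrBr -scalerAr mulrA yxe => /(congr1 (GRing.scale (r ^+ 2 / (1 - r^-1)))).
rewrite !scalerA.
move: (y * y) (x * y * e) => u v.
rewrite !(scalerDr, scalerBr, scalerA).
rewrite scalerN scalerA mulrAC => ->; rewrite -scaleNr -scalerDl -!addrA.
rewrite (addrCA (_ *: x)) -scalerDl [_ *: v + _]addrA -scalerDl.
have r1' : r - 1 != 0 by rewrite -(mulr1 r) -[X in _ - X](mulfV r0) -mulrBr mulf_neq0.
set c1 := (X in X *: u); set c2 := (X in X *: v); set c3 := (X in X *: x).
have -> : c1 = 1 by rewrite /c1; field; rewrite ?r0 ?r1'.
have -> : c2 = 0 by rewrite /c2; field; rewrite ?r0 ?r1'.
have -> : c3 = 0 by rewrite /c3; field; rewrite ?r0 ?r1'.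
by rewrite scale1r !scale0r !addr0.
Qed.

(** * The quotient satisfies the abstract hypotheses *)

Section Presentation.
Variables (R : realType) (q alpha beta : R[i]).
Hypothesis q_neq0 : q != 0.
Hypothesis q_nroot : forall n : nat, (0 < n)%N -> q ^+ n != 1.
Local Notation r := (q ^+ 2).

Lemma q2_neq0 : r != 0. Proof. exact: expf_neq0. Qed.

Lemma q2_nroot n : (0 < n)%N -> r ^+ n != 1.
Proof. by move=> n0; rewrite -exprM q_nroot // muln_gt0. Qed.

Lemma oneBq_neq0 n : (0 < n)%N -> 1 - q ^+ n != 0.
Proof. by move=> n0; rewrite subr_eq0 eq_sym q_nroot. Qed.

Lemma oneBqV_neq0 n : (0 < n)%N -> 1 - q ^- n != 0.
Proof. by move=> n0; rewrite subr_eq0 eq_sym invr_eq1 q_nroot. Qed.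

(** These two constants invert [act_z] and [act_z'], making z act as [alpha] and z' as [beta]. *)
Definition cst_c := alpha / (1 - r).
Definition cst_a := beta / ((1 - q ^- 2) * (1 - q ^- 4)).

Let W := laurent_space R[i].
Let opx : {linear W -> W} := @op_x R[i].
Let ope : {linear W -> W} := op_e cst_a cst_c q2_neq0.
Let op (i : 'I_2) : {linear W -> W} := if i == ord0 then opx else ope.

Let actF := free_act op.
Let actU : Uplus q -> W -> W := @quot_act _ _ _ (@serre_relations R q) actF.
Definition Aab_act : Aab q alpha beta -> W -> W :=
  @quot_act _ _ (Uplus q) (@central_relations R q alpha beta) actU.

Let actF1 w : actF (free_gen R[i] ord0) w = op_x w.
Proof. exact: free_act_gen. Qed.
Let actF2 w : actF (free_gen R[i] ord_max) w = op_e cst_a cst_c q2_neq0 w.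
Proof. exact: free_act_gen. Qed.
Let actFP : is_action *:%R actF.
Proof. exact: free_act_action. Qed.

Let q4_neq1 : 1 - r ^+ 2 != 0.
Proof. by rewrite -exprM oneBq_neq0. Qed.

Let actFS s : serre_relations q s -> forall w, actF s w = 0.
Proof.
by case=> -> w; [apply: (act_serre1 q_neq0 q4_neq1 actFP actF1 actF2)
                |apply: (act_serre2 q_neq0 q4_neq1 actFP actF1 actF2)].
Qed.

Let actUP : is_action (A := Uplus q) *:%R actU.
Proof. exact: quot_act_action. Qed.
Let actU1 w : actU (e1 q) w = op_x w.
Proof. exact: etrans (congr1 (fun f => f w) (quot_act_pi actFP actFS _)) (actF1 w). Qed.
Let actU2 w : actU (e2 q) w = op_e cst_a cst_c q2_neq0 w.
Proof. exact: etrans (congr1 (fun f => f w) (quot_act_pi actFP actFS _)) (actF2 w). Qed.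

Let actUS s : @central_relations R q alpha beta s -> forall w, actU s w = 0.
Proof.
have [aone _ aD aZ] := actUP.
have aB (u : Uplus q) d w : actU (u - d *: 1) w = actU u w - d *: w.
  by rewrite -scaleNr aD aZ aone scaleNr.
case=> -> w; rewrite aB.
  rewrite (act_z q_neq0 q4_neq1 actUP actU1 actU2).
  by rewrite /cst_c mulrC divfK ?subrr ?oneBq_neq0.
rewrite (act_z' q_neq0 q4_neq1 actUP actU1 actU2).
by rewrite /cst_a mulrC divfK ?subrr // mulf_neq0 ?oneBqV_neq0.
Qed.

Lemma Aab_act_action : is_action (A := Aab q alpha beta) *:%R Aab_act.
Proof. exact: quot_act_action. Qed.

Local Notation x := (Aab_pi alpha beta (e1 q)).
Local Notation e := (Aab_pi alpha beta (e2 q)).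
Local Notation y := (Aab_pi alpha beta (e3 q)).

Lemma Aab_act_x w : Aab_act x w = op_x w.
Proof. exact: etrans (congr1 (fun f => f w) (quot_act_pi actUP actUS _)) (actU1 w). Qed.

Lemma Aab_act_e w : Aab_act e w = op_e cst_a cst_c q2_neq0 w.
Proof. exact: etrans (congr1 (fun f => f w) (quot_act_pi actUP actUS _)) (actU2 w). Qed.

(** Coefficients are read off by applying [u] to the vector that represents 1; the value at t = 0 is
    set to 0 by default. *)
Definition Aab_coef (u : Aab q alpha beta) (k : int) (t : R[i]) : R[i] :=
  if insub t is Some t' then
    Aab_act u (fun p => (p.1 == 0)%:R) (k, t' : nonzero R[i])
  else 0.

(** The unit acts as the identity on a nonzero space. *)
Lemma Aab_neq0 : (1 : Aab q alpha beta) != 0.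
Proof.
have [a1 _ _ aZ] := Aab_act_action.
pose w : W := fun=> 1.
have act0 : Aab_act (0 : Aab q alpha beta) w = 0.
  by have := aZ 0 0 w; rewrite !scale0r.
apply/eqP => e10; move: act0; rewrite -e10 (a1 w).
move/(congr1 (fun f : W => f (0, exist _ 1 (oner_neq0 _)))) => /eqP.
by rewrite -[_ == _]/((1 : R[i]) == 0) oner_eq0.
Qed.

Local Notation A := (nz_Aab_alg Aab_neq0).

Let piD (u v : Uplus q) :
  Aab_pi alpha beta (u + v) = Aab_pi alpha beta u + Aab_pi alpha beta v.
Proof. exact: quot_piD. Qed.
Let piN (u : Uplus q) : Aab_pi alpha beta (- u) = - Aab_pi alpha beta u.
Proof. exact: (rmorphN (quot_pi (central_relations alpha beta))). Qed.
Let piM (u v : Uplus q) :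
  Aab_pi alpha beta (u * v) = Aab_pi alpha beta u * Aab_pi alpha beta v.
Proof. exact: (rmorphM (quot_pi (central_relations alpha beta))). Qed.
Let piZ d (u : Uplus q) : Aab_pi alpha beta (d *: u) = d *: Aab_pi alpha beta u.
Proof. exact: quot_piZ. Qed.

Lemma Aab_gen (P : A -> Prop) : P 1 ->
  (forall u v, P u -> P v -> P (u + v)) -> (forall k u, P u -> P (k *: u)) ->
  (forall u, P u -> P (x * u)) -> (forall u, P u -> P (e * u)) -> forall u, P u.
Proof.
(* Lift through both quotients to the free algebra, where words are built from the left. *)
move=> P1 PD PZ Px Pe; elim/quotW => u; elim/quotW: u => u.
rewrite -[quot_pi _ _]/(Aab_pi alpha beta (Uplus_pi q u)).
elim/free_alg_ind: u => [|u v Pu Pv|d u Pu|i u Pu].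
- exact: P1.
- by rewrite rmorphD piD; exact: (PD _ _ Pu Pv).
- by rewrite linearZ piZ; exact: (PZ _ _ Pu).
rewrite rmorphM piM; have [->|i0] := eqVneq i ord0; first exact: (Px _ Pu).
have -> : i = ord_max by apply/val_inj; case: i i0 => [[|[|[]]] ?].
exact: (Pe _ Pu).
Qed.

Lemma insub_nz (t : R[i]) (t0 : t != 0) : insub t = Some (exist _ t t0 : nonzero R[i]).
Proof. by rewrite insubT. Qed.

Lemma Aab_coefD (u v : A) k t : Aab_coef (u + v) k t = Aab_coef u k t + Aab_coef v k t.
Proof.
rewrite /Aab_coef; case: insub => [t'|]; last by rewrite addr0.
by have [_ _ aD _] := Aab_act_action; rewrite (aD u v).
Qed.

Lemma Aab_coefZ d (u : A) k t : Aab_coef (d *: u) k t = d * Aab_coef u k t.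
Proof.
rewrite /Aab_coef; case: insub => [t'|]; last by rewrite mulr0.
by have [_ _ _ aZ] := Aab_act_action; rewrite (aZ d u).
Qed.

Lemma Aab_coef1 k (t : R[i]) : t != 0 -> Aab_coef (1 : A) k t = (k == 0)%:R.
Proof.
move=> t0; rewrite /Aab_coef (insub_nz t0).
by have [a1 _ _ _] := Aab_act_action; rewrite a1.
Qed.

Lemma Aab_coef_x (u : A) k (t : R[i]) : t != 0 ->
  Aab_coef ((x : A) * u) k t = t * Aab_coef u k t.
Proof.
move=> t0; rewrite /Aab_coef (insub_nz t0).
by have [_ aM _ _] := Aab_act_action; rewrite (aM x u) Aab_act_x.
Qed.

Lemma Aab_coef_e (u : A) k (t : R[i]) : t != 0 -> Aab_coef ((e : A) * u) k t
  = Ac cst_a cst_c t * Aab_coef u (k + 1) (rshift r (-1) t)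
  + Bc r t * Aab_coef u (k - 1) (rshift r 1 t).
Proof.
move=> t0; rewrite /Aab_coef (insub_nz t0).
have st k' := insub_nz (rshift_neq0 q2_neq0 k' t0); rewrite !st.
have [_ aM _ _] := Aab_act_action; rewrite (aM e u) Aab_act_e.
have E k' : nzshift q2_neq0 k' (exist _ t t0)
    = exist _ (rshift r k' t) (rshift_neq0 q2_neq0 k' t0) by apply: val_inj.
by rewrite /op_e !E.
Qed.

Lemma def_e3 : (y : A) = (x : A) * e - r *: ((e : A) * x).
Proof. by rewrite /e3 piD piN piZ !piM. Qed.

Lemma rel_e1_e3 : (x : A) * y = r^-1 *: ((y : A) * x).
Proof.
have [s1 _] := Uplus_serre q; apply/eqP; rewrite -subr_eq0; apply/eqP.
have : Aab_pi alpha beta (serre1 q (e1 q) (e2 q)) = 0.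
  by rewrite s1; have := piZ 0 0; rewrite !scale0r.
rewrite serre1E // -/(e3 q) => <-.
by rewrite [in RHS]piD [in RHS]piN [in RHS]piZ ![in RHS]piM.
Qed.

Lemma rel_e2_e3 : (e : A) * y = r *: ((y : A) * e) + alpha *: (1 : A).
Proof.
have [pz _] := Aab_piE q alpha beta.
have -> : alpha *: (1 : A) = (e : A) * y - r *: ((y : A) * e).
  by rewrite -[LHS]pz /z [in LHS]piD [in LHS]piN [in LHS]piZ ![in LHS]piM.
by rewrite addrC subrK.
Qed.

Lemma rel_e3_sqr : (y : A) * y = (r ^+ 2 * beta / (1 - r^-1)) *: (1 : A)
  + (- (r * (r ^+ 2 - 1))) *: ((x : A) * y * e) + (- (r * (r + 1) * alpha)) *: (x : A).
Proof.
have [pz pz'] := Aab_piE q alpha beta.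
apply: (e3_sqrE (r := r)); [exact: q2_neq0|exact: oneBqV_neq0|exact: def_e3|exact: rel_e1_e3|].
have -> : beta *: (1 : A) = Aab_pi alpha beta (z' q) by rewrite pz'.
rewrite /z' piZ piD piZ !piM pz; congr (_ *: (_ * _ + _)).
by rewrite /e3bar [in LHS]piD [in LHS]piN [in LHS]piZ ![in LHS]piM.
Qed.

Hypotheses (alpha_neq0 : alpha != 0) (beta_neq0 : beta != 0).

Lemma Aab_properties :
  [/\ simple_algebra A,
      forall u : A, invertible u -> exists2 d : R[i], d != 0 & u = d *: (1 : A)
    & center A = [set d *: (1 : A) | d in [set: R[i]]]].
Proof.
(* Nonvanishing of [alpha] gives that of [c]; nonvanishing of [beta] gives that of [a] and of the
   constant term of y^2. *)
have c0 : cst_c != 0 by rewrite mulf_neq0 ?invr_neq0 ?oneBq_neq0.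
have a0 : cst_a != 0.
  by rewrite mulf_neq0 // invr_neq0 // mulf_neq0 // oneBqV_neq0.
have b0 : r ^+ 2 * beta / (1 - r^-1) != 0.
  by rewrite !mulf_neq0 ?invr_neq0 ?oneBqV_neq0 // expf_neq0 // q2_neq0.
have := @laurent_coef_properties _ r q2_neq0 q2_nroot _ _ a0 c0 A x e y Aab_coef
  def_e3 Aab_gen Aab_coefD Aab_coefZ Aab_coef1 Aab_coef_x Aab_coef_e
  alpha _ _ _ alpha_neq0 b0 rel_e1_e3 rel_e2_e3 rel_e3_sqr.
by [].
Qed.

End Presentation.

Theorem proposition3p7 (R : realType) (q alpha beta : R[i])
  (q_neq0 : q != 0)
  (q_not_root1 : forall n : nat, (0 < n)%N -> q ^+ n != 1)
  (alpha_neq0 : alpha != 0) (beta_neq0 : beta != 0) :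
  [/\ simple_algebra (Aab q alpha beta),
      forall x : Aab q alpha beta,
        invertible x -> exists2 c : R[i], c != 0 & x = c *: (1 : Aab q alpha beta)
    & center (Aab q alpha beta) =
        [set c *: (1 : Aab q alpha beta) | c in [set: R[i]]]].
Proof. exact: Aab_properties q_neq0 q_not_root1 alpha_neq0 beta_neq0. Qed.
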